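(* Let $\mathcal{R}\subset\mathcal{O}=\mathbb{F}_q[[z]]$ be any unibranch singularity ring (not necessarily Gorenstein or with $2$ generators), let $c\ge1$ and $\Omega=\mathcal{O}^{\oplus c}$. Then the sum over all standard flags $M_0\subset M_1\subset\cdots\subset M_\ell\subset\Omega$ of all lengths $\ell\geq 0$ $$\mathcal{H}^{mot}(q,t,a,c;\mathcal{R})=\sum_{\{M_0\subset\cdots\subset M_\ell\}}t^{\deg(M_\ell)}a^\ell$$ is finite, and $$\mathcal{H}^{mot}(q,t,a,c;\mathcal{R})=\sum_{M}t^{\deg(M)}\prod_{i=c}^{rk_q(M)-1}(1+q^ia),$$ where the summation is over all standard $M\subset\Omega$ (for which always $rk_q(M)\ge c$), and the product is $1$ when $rk_q(M)=c$.
   Context: A unibranch singularity ring is an $\mathbb{F}_q$-subalgebra $\mathcal{R}\subset\mathcal{O}=\mathbb{F}_q[[z]]$ with $1\in\mathcal{R}$ that is complete local with field of fractions $\mathbb{F}_q((z))$; equivalently $z^N\mathcal{O}\subset\mathcal{R}$ for some $N$. Put $\mathfrak{m}_{\mathcal R}=\mathcal{R}\cap z\mathcal{O}$, $\mathbb{Z}_+=\{0,1,2,\dots\}$, and let $\nu_z$ be the $z$-adic valuation. Let $\Omega=\oplus_{i=1}^c\mathcal{O}\varepsilon_i$ with a fixed basis, and fix real numbers $0=\nu^1<\nu^2<\cdots<\nu^c<1$. Define $\nu(\sum_i f_i\varepsilon_i)=\min_i(\nu_z(f_i)+\nu^i)$, so $\nu(\Omega\setminus\{0\})=\cup_i\{\nu^i+\mathbb{Z}_+\}$.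 $\mathcal{R}$ acts on $\Omega$ diagonally. For an $\mathcal{R}$-submodule $M\subset\Omega$ put $\Delta^{c}(M)=\{\nu(v)\mid0\ne v\in M\}$, $\deg(M)=\dim_{\mathbb{F}_q}(\Omega/M)$, $rk_q(M)=\dim_{\mathbb{F}_q}(M/\mathfrak{m}_{\mathcal R}M)$. $M$ is called standard if $\mathcal{O}M=\Omega$ (equivalently, $\nu^1,\ldots,\nu^c\in\Delta^c(M)$). A standard $\ell$-flag ($\ell\ge0$) is a chain $M_0\subset\cdots\subset M_\ell\subset\Omega$ of $\mathcal{R}$-submodules with $M_0$ standard, $\dim_{\mathbb{F}_q}M_i/M_{i-1}=1$, $\Delta^c(M_i)=\Delta^c(M_{i-1})\cup\{g_i\}$ (disjoint union) for $1\le i\le\ell$, and $g_1<g_2<\cdots<g_\ell$. *)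

(* Defs.v *)
From HB Require Import structures.
From mathcomp Require Import all_boot all_order all_algebra.
From mathcomp Require Import all_classical all_reals.

Set Implicit Arguments.
Unset Strict Implicit.
Unset Printing Implicit Defensive.

Import Order.TTheory GRing.Theory Num.Theory.
Local Open Scope classical_set_scope.
Local Open Scope ring_scope.

(* F[[z]].  A record rather than an alias of [nat -> F], because the latter
   already carries the pointwise ring structure. *)
Record fps (F : fieldType) := Fps { fcoef : nat -> F }.

Notation "{ 'fps' F }" := (fps F) (at level 0, format "{ 'fps'  F }").

HB.instance Definition _ (F : fieldType) := gen_eqMixin {fps F}.
HB.instance Definition _ (F : fieldType) := gen_choiceMixin {fps F}.

Section PowerSeriesRing.
Variable F : fieldType.
Implicit Types (f g h : {fps F}) (x y : F).

Lemma fpsP f g : fcoef f =1 fcoef g -> f = g.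
Proof. by case: f g => [f] [g] /= /funext ->. Qed.

Definition fps0 : {fps F} := Fps (fun=> 0).
Definition fps_opp f := Fps (fun n => - fcoef f n).
Definition fps_add f g := Fps (fun n => fcoef f n + fcoef g n).
Definition fps1 : {fps F} := Fps (fun n => (n == 0%N)%:R).
Definition fps_mul f g :=
  Fps (fun n => \sum_(i < n.+1) fcoef f i * fcoef g (n - i)%N).
Definition fps_scale x f := Fps (fun n => x * fcoef f n).

Fact fps_addA : associative fps_add.
Proof. by move=> f g h; apply: fpsP => n /=; rewrite addrA. Qed.
Fact fps_addC : commutative fps_add.
Proof. by move=> f g; apply: fpsP => n /=; rewrite addrC. Qed.
Fact fps_add0 : left_id fps0 fps_add.
Proof. by move=> f; apply: fpsP => n /=; rewrite add0r. Qed.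
Fact fps_addN : left_inverse fps0 fps_opp fps_add.
Proof. by move=> f; apply: fpsP => n /=; rewrite addNr. Qed.

HB.instance Definition _ :=
  GRing.isZmodule.Build {fps F} fps_addA fps_addC fps_add0 fps_addN.

Definition fps_trunc n f : {poly F} := \poly_(i < n.+1) fcoef f i.

Lemma fcoef_mul_trunc n k f g : (k <= n)%N ->
  fcoef (fps_mul f g) k = (fps_trunc n f * fps_trunc n g)`_k.
Proof.
move=> kn; rewrite coefM /=; apply: eq_bigr => i _.
by rewrite !coef_poly !ltnS (leq_trans (leq_subr _ _) kn)
  (leq_trans _ kn) // -ltnS.
Qed.

Fact fps_mulC : commutative fps_mul.
Proof.
by move=> f g; apply: fpsP => n; rewrite !(@fcoef_mul_trunc n) // mulrC.
Qed.

Fact fps_mulA : associative fps_mul.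
Proof.
have E f g h n : fcoef (fps_mul (fps_mul f g) h) n =
    (fps_trunc n f * fps_trunc n g * fps_trunc n h)`_n.
  rewrite [RHS]coefM [LHS]/=; apply: eq_bigr => i _.
  have le_in : (i <= n)%N by rewrite -ltnS.
  congr (_ * _); first exact: (@fcoef_mul_trunc n).
  by rewrite coef_poly ltnS leq_subr.
move=> f g h; apply: fpsP => n.
by rewrite fps_mulC !E mulrC mulrA.
Qed.

Fact fps_mul1 : left_id fps1 fps_mul.
Proof.
move=> f; apply: fpsP => n /=.
rewrite big_ord_recl /= mul1r subn0 big1 ?addr0 // => i _.
by rewrite mul0r.
Qed.

Fact fps_mulDl : left_distributive fps_mul fps_add.
Proof.
move=> f g h; apply: fpsP => n /=; rewrite -big_split /=.
by apply: eq_bigr => i _; rewrite mulrDl.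
Qed.

Fact fps1_neq0 : fps1 != 0.
Proof.
by apply/eqP => /(congr1 (fun f => fcoef f 0%N)) /= /eqP; rewrite oner_eq0.
Qed.

HB.instance Definition _ := GRing.Zmodule_isComNzRing.Build {fps F}
  fps_mulA fps_mulC fps_mul1 fps_mulDl fps1_neq0.

Fact fps_scaleA x y f : fps_scale x (fps_scale y f) = fps_scale (x * y) f.
Proof. by apply: fpsP => n /=; rewrite mulrA. Qed.
Fact fps_scale1 : left_id 1 fps_scale.
Proof. by move=> f; apply: fpsP => n /=; rewrite mul1r. Qed.
Fact fps_scaleDr : right_distributive fps_scale +%R.
Proof. by move=> x f g; apply: fpsP => n /=; rewrite mulrDr. Qed.
Fact fps_scaleDl f : {morph fps_scale^~ f : x y / x + y}.
Proof. by move=> x y; apply: fpsP => n /=; rewrite mulrDl. Qed.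

HB.instance Definition _ := GRing.Zmodule_isLmodule.Build F {fps F}
  fps_scaleA fps_scale1 fps_scaleDr fps_scaleDl.

Fact fps_scaleAl x f g : x *: (f * g) = x *: f * g.
Proof.
apply: fpsP => n /=; rewrite mulr_sumr.
by apply: eq_bigr => i _; rewrite mulrA.
Qed.

HB.instance Definition _ :=
  GRing.Lmodule_isLalgebra.Build F {fps F} fps_scaleAl.

Definition fps_unit f : bool := `[< exists g, g * f = 1 >].
Definition fps_inv f : {fps F} :=
  if pselect (exists g, g * f = 1) is left uf then projT1 (cid uf) else f.

Fact fps_mulV : {in fps_unit, left_inverse 1 fps_inv *%R}.
Proof.
move=> f /asboolP uf; rewrite /fps_inv.
by case: pselect => // uf'; exact: projT2 (cid uf').
Qed.
Fact fps_unitP f g : g * f = 1 -> fps_unit f.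
Proof. by move=> gf; apply/asboolP; exists g. Qed.
Fact fps_inv_out : {in [predC fps_unit], fps_inv =1 id}.
Proof.
move=> f; rewrite inE /= => /asboolPn nuf; rewrite /fps_inv.
by case: pselect.
Qed.

HB.instance Definition _ := GRing.ComNzRing_hasMulInverse.Build {fps F}
  fps_mulV fps_unitP fps_inv_out.

Lemma fps_neq0 f : f != 0 -> exists n, fcoef f n != 0.
Proof.
move=> f0; apply: contrapT => nex; case/eqP: f0; apply: fpsP => n /=.
by apply/eqP/negPn/negP => fn; apply: nex; exists n.
Qed.

Fact fps_mulf_eq0 f g : f * g = 0 -> (f == 0) || (g == 0).
Proof.
move=> fg; apply/norP => -[/fps_neq0 exf /fps_neq0 exg].
case: (ex_minnP exf) (ex_minnP exg) => m fm minf [n gn ming].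
have /eqP := congr1 (fun h => fcoef h (m + n)%N) fg; rewrite /=.
have lt_m : (m < (m + n).+1)%N by rewrite ltnS leq_addr.
rewrite (bigD1 (Ordinal lt_m)) //= addKn big1 ?addr0.
  by rewrite mulf_eq0 (negPf fm) (negPf gn).
move=> i; rewrite -val_eqE /= => im.
have [lt_im | le_mi] := ltnP i m.
  have /eqP -> : fcoef f i == 0.
    by apply: contraTT lt_im => /minf; rewrite -leqNgt.
  by rewrite mul0r.
have lt_mi : (m < i)%N by rewrite ltn_neqAle eq_sym im.
have /eqP -> : fcoef g (m + n - i)%N == 0.
  apply: contraTT lt_mi => /ming le_n; rewrite -leqNgt.
  have le_i : (i <= m + n)%N by rewrite -ltnS.
  by have := leq_add le_n (leqnn i); rewrite subnK // addnC leq_add2r.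
by rewrite mulr0.
Qed.

HB.instance Definition _ :=
  GRing.ComUnitRing_isIntegral.Build {fps F} fps_mulf_eq0.

End PowerSeriesRing.

Section Submodules.
Variables (F : fieldType) (V : lmodType {fps F}).

(* The additive subgroup I.M generated by the products f *: v. *)
Definition smul (I : set {fps F}) (M : set V) : set V :=
  [set w | exists n (f : 'I_n -> {fps F}) (v : 'I_n -> V),
     [/\ forall k, I (f k), forall k, M (v k) & w = \sum_(k < n) f k *: v k]].

Definition is_submod (R : set {fps F}) (M : set V) : Prop :=
  [/\ M 0, (forall u v, M u -> M v -> M (u + v))
    & (forall r v, R r -> M v -> M (r *: v))].

(* dim_F (A / B) = n, for F-subspaces B `<=` A: some n vectors of A form a
   basis modulo B.  The scalar x : F acts as the constant series x%:A. *)
Definition has_dimq (A B : set V) (n : nat) : Prop :=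
  exists e : 'I_n -> V, (forall k, A (e k)) /\
    forall v, A v ->
      exists! x : {ffun 'I_n -> F}, B (v - \sum_(k < n) (x k)%:A *: e k).

(* dim_F (A / B) when it is finite, 0 otherwise. *)
Definition dimq (A B : set V) : nat := xget 0%N (has_dimq A B).

End Submodules.

Section UnibranchRings.
Variable F : fieldType.
Implicit Types R I m : set {fps F}.

Definition is_ideal R I : Prop := I `<=` R /\ @is_submod F {fps F}^o R I.

Definition is_maximal_ideal R m : Prop :=
  [/\ is_ideal R m, ~ m 1
    & forall I, is_ideal R I -> ~ I 1 -> m `<=` I -> I = m].

Definition ideal_pow R I (n : nat) : set {fps F} :=
  iter n (@smul F {fps F}^o I) R.

(* The canonical map from R to the inverse limit of the R / m^n is bijective. *)
Definition adic_complete R m : Prop :=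
  (forall f, (forall n, ideal_pow R m n f) -> f = 0) /\
  (forall u : nat -> {fps F}, (forall n, R (u n)) ->
     (forall n, ideal_pow R m n (u n.+1 - u n)) ->
     exists2 f, R f & forall n, ideal_pow R m n (f - u n)).

Definition complete_local R : Prop :=
  exists m, [/\ is_maximal_ideal R m, (forall m', is_maximal_ideal R m' -> m' = m)
              & adic_complete R m].

(* F((z)) is {fraction {fps F}}. *)
Definition has_full_fraction_field R : Prop :=
  forall x : {fraction {fps F}}, exists f g,
    [/\ R f, R g, g != 0 & x = FracField.tofrac f / FracField.tofrac g].

Definition unibranch_singularity_ring R : Prop :=
  [/\ GRing.subalg_closed [in R], complete_local R & has_full_fraction_field R].

(* m_R, the intersection of R with z F[[z]]. *)
Definition maxid R : set {fps F} := [set f | R f /\ fcoef f 0%N = 0].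

End UnibranchRings.

Section Flags.
Variables (F : fieldType) (K : realType) (c : nat) (nu : 'I_c -> K).
Implicit Types (R : set {fps F}) (M : set 'rV[{fps F}]_c).

Definition valz (f : {fps F}) : \bar K :=
  if pselect (exists n, fcoef f n != 0) is left exf
  then ((ex_minn exf)%:R)%:E else +oo%E.

Definition val_nu (v : 'rV[{fps F}]_c) : \bar K :=
  \big[mine/+oo%E]_(i < c) (valz (v 0%R i) + (nu i)%:E)%E.

Definition Delta M : set K :=
  [set x | exists v, [/\ M v, v != 0 & val_nu v = x%:E]].

Definition degq M : nat := dimq [set: 'rV[{fps F}]_c] M.

Definition rkq R M : nat := dimq M (smul (maxid R) M).

Definition standard R M : Prop :=
  is_submod R M /\ smul [set: {fps F}] M = [set: 'rV[{fps F}]_c].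

(* s = [:: M_0; ...; M_l] *)
Definition standard_flag R (l : nat) (s : seq (set 'rV[{fps F}]_c)) : Prop :=
  [/\ size s = l.+1, standard R (nth set0 s 0%N),
      (forall i, (i <= l)%N -> is_submod R (nth set0 s i)),
      (forall i, (i < l)%N -> nth set0 s i `<=` nth set0 s i.+1 /\
                              has_dimq (nth set0 s i.+1) (nth set0 s i) 1%N)
    & exists g : nat -> K,
        (forall i, (i < l)%N -> ~ Delta (nth set0 s i) (g i) /\
           Delta (nth set0 s i.+1) = Delta (nth set0 s i) `|` [set g i]) /\
        (forall i j, (i < j < l)%N -> g i < g j)].

Definition standard_flags R : set (seq (set 'rV[{fps F}]_c)) :=
  [set s | exists l, standard_flag R l s].

(* The variables t and a take values in an arbitrary commutative ring (for
   instance the polynomial ring over int in two variables). *)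
Definition Hmot R (A : comNzRingType) (t a : A) : A :=
  \sum_(s \in standard_flags R) t ^+ degq (last set0 s) * a ^+ (size s).-1.

End Flags.

(* Main.v *)
Require Import Defs.
From mathcomp Require Import all_boot all_order all_algebra.
From mathcomp Require Import all_classical all_reals.
From mathcomp Require Import zify.
Local Open Scope classical_set_scope.
Local Open Scope ring_scope.

Set Implicit Arguments.
Unset Strict Implicit.
Unset Printing Implicit Defensive.
Import Order.TTheory GRing.Theory Num.Theory.

(** Why the identity holds.

    Write [m] for the maximal ideal of [R]. Group the flags by their top
    module [M]; then the claim is that, for every standard [M],
<<
      sum over the flags ending at M of a ^ length
        = prod_(c <= i < rk M) (1 + q ^ i a).
>>
    Since the [nu i] are distinct and lie in [0, 1[, the values of the
    valuation on [Omega] are in increasing bijection with [nat]: the monomial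
    [z ^ n e_i] gets the index [n c + i]. So [Omega] is the space of sequences
    over [F], a submodule [M] has a set [ords M] of indices of leading terms,
    and two leading terms of the same index differ by a scalar. As a standard
    module contains every vector of large index, inclusions and dimensions of
    subspaces can be read off from these sets ([ords_mem], [comb_dimq]). In
    particular [rk M] is the number of jumps of [M], the indices in [ords M]
    that are not in [ords (m M)]; the first [c] indices are always jumps.

    Let [M'] be a submodule of [M] with [ords M = ords M' + {b}]. Then [M']
    contains all vectors of [M] of index above [b], and, since [m] raises the
    index, also [m M]: so [b] is a jump ([hyper_maxid], [hyper_jump]).
    Conversely, for a jump [b] the possible [M'] are the graphs of linear
    functions from the span of the basis vectors at the jumps below [b] to the
    line at [b]; there are [q ^ i] of them, where [i] is the number of jumps
    below [b] ([hyper_bij]). Such an [M'] is standard exactly when [c <= b],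
    and it has the same jumps below [b] as [M] ([hyper_jump_lt]), although
    [m M'] may be smaller than [m M]. As the indices removed along a flag,
    read from the top, decrease, the next choice only involves these jumps,
    so each jump beyond the first [c] is independently either kept or removed
    in [q ^ i] ways ([flag_sumE]). This gives the product.

    It remains to know that [R] contains [z ^ N F[[z]]] for some [N]
    ([conductor]). A fraction equal to [z] provides [g] with [g] and [f = z g]
    in [R]; if [g] has order [n], then modulo [f] every multiple of [g ^ n]
    agrees with a combination of the [z ^ j g ^ n = f ^ j g ^ (n - j)],
    [j <= n], all in [R]. Iterating expands it as a series in powers of [f]
    with coefficients in [R], which converges in [R] by completeness. *)

(** * Orders and division of power series *)

Section PowerSeries.
Variable F : fieldType.
Implicit Types (f g h : {fps F}) (x y : F).

Lemma fcoefD f g n : fcoef (f + g) n = fcoef f n + fcoef g n.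
Proof. by []. Qed.

Lemma fcoefN f n : fcoef (- f) n = - fcoef f n.
Proof. by []. Qed.

Lemma fcoef1 n : fcoef (1 : {fps F}) n = (n == 0)%:R.
Proof. by []. Qed.

Lemma fcoefM f g n :
  fcoef (f * g) n = \sum_(i < n.+1) fcoef f i * fcoef g (n - i).
Proof. by []. Qed.

Lemma fcoefZ x f n : fcoef (x *: f) n = x * fcoef f n.
Proof. by []. Qed.

Lemma fcoefAM x f n : fcoef (x%:A * f) n = x * fcoef f n.
Proof. by rewrite -scalerAl mul1r. Qed.

Lemma fcoefM0 f g : fcoef (f * g) 0 = fcoef f 0 * fcoef g 0.
Proof. by rewrite fcoefM big_ord_recl big_ord0 addr0. Qed.

Lemma fcoef_sum (I : Type) (r : seq I) (P : pred I) (f : I -> {fps F}) n :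
  fcoef (\sum_(i <- r | P i) f i) n = \sum_(i <- r | P i) fcoef (f i) n.
Proof. by apply: (big_morph (fun g => fcoef g n)). Qed.

Definition fpsX n : {fps F} := Fps (fun k => (k == n)%:R).

Lemma fcoefX n k : fcoef (fpsX n) k = (k == n)%:R.
Proof. by []. Qed.

Lemma fcoefXM n f k :
  fcoef (fpsX n * f) k = if (n <= k)%N then fcoef f (k - n) else 0.
Proof.
rewrite fcoefM /=; case: leqP => nk.
  rewrite (bigD1 (inord n)) //= inordK ?ltnS // eqxx mul1r big1 ?addr0 // => i.
  rewrite -val_eqE /= inordK ?ltnS // => /negPf ->.
  by rewrite mul0r.
rewrite big1 // => i _; case: eqP => [E|]; last by rewrite mul0r.
by have := ltn_ord i; rewrite E ltnS leqNgt nk.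
Qed.

Lemma fpsXD m n : fpsX (m + n)%N = fpsX m * fpsX n.
Proof.
apply: fpsP => k; rewrite fcoefXM /=; case: leqP => mk.
  by congr (_%:R); lia.
by rewrite (_ : (k == m + n)%N = false) //; lia.
Qed.

Lemma fpsX_exp m k : fpsX (m * k)%N = fpsX m ^+ k.
Proof.
elim: k => [|k IH]; last by rewrite mulnS fpsXD IH exprS.
by rewrite muln0; apply: fpsP => -[].
Qed.

Definition flow n f := forall k, (k < n)%N -> fcoef f k = 0.

Lemma flow_mulX n f : flow n f -> exists g, f = fpsX n * g.
Proof.
move=> fn; exists (Fps (fun k => fcoef f (n + k))); apply: fpsP => k.
by rewrite fcoefXM; case: leqP => [nk|/fn //]; rewrite /= subnKC.
Qed.

Lemma flowMX n f : flow n (fpsX n * f).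
Proof. by move=> k kn; rewrite fcoefXM leqNgt kn. Qed.

Lemma flow_eq0 f : (forall n, flow n f) -> f = 0.
Proof. by move=> f0; apply: fpsP => k; rewrite (f0 k.+1). Qed.

Lemma flowB n f g : flow n f -> flow n g -> flow n (f - g).
Proof. by move=> f0 g0 k kn; rewrite fcoefD fcoefN f0 // g0 // subrr. Qed.

Lemma flowMl n f g : flow n f -> flow n (g * f).
Proof. by case/flow_mulX => h ->; rewrite mulrCA; apply: flowMX. Qed.

Lemma flowM m n f g : flow m f -> flow n g -> flow (m + n)%N (f * g).
Proof.
move=> /flow_mulX[f' ->] /flow_mulX[g' ->].
by rewrite mulrACA -fpsXD; apply: flowMX.
Qed.

Lemma flow_exp f n : flow 1 f -> flow n (f ^+ n).
Proof.
move=> f1; elim: n => [k //|n IH]; rewrite exprS.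
by apply: (flowM f1 IH).
Qed.

(** After scaling, [f = 1 - u] with [u] of positive order, and the inverse is
    the geometric series in [u]: its coefficient at [n] is already that of the
    partial sum up to [u ^ n]. *)
Lemma fps_inverse f : fcoef f 0 != 0 -> exists g, g * f = 1.
Proof.
move=> f0; set x := fcoef f 0 in f0.
pose u := 1 - x^-1%:A * f.
have u1 : flow 1 u.
  by case=> // _; rewrite fcoefD fcoefN fcoefAM fcoef1 mulVf // subrr.
pose s n := \sum_(i < n) u ^+ i.
have sE n k : (k <= n)%N -> fcoef (s n.+1) k = fcoef (s k.+1) k.
  elim: n => [|n IH]; first by rewrite leqn0 => /eqP ->.
  rewrite leq_eqVlt => /orP[/eqP -> //|]; rewrite ltnS => kn.
  rewrite /s big_ord_recr fcoefD IH //= (flow_exp u1) ?addr0 //.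
pose v : {fps F} := Fps (fun n => fcoef (s n.+1) n).
have uv : (1 - u) * v = 1.
  apply: fpsP => n.
  have -> : fcoef ((1 - u) * v) n = fcoef ((1 - u) * s n.+1) n.
    rewrite !fcoefM; apply: eq_bigr => i _; congr (_ * _).
    by rewrite /= [RHS]sE // leq_subr.
  have -> : (1 - u) * s n.+1 = 1 - u ^+ n.+1.
    by rewrite -opprB mulNr -subrX1 opprB.
  by rewrite fcoefD fcoefN (flow_exp u1) // subr0.
exists (v * x^-1%:A); rewrite -mulrA mulrC.
by have -> : x^-1%:A * f = 1 - u by rewrite /u opprB addrC subrK.
Qed.

Lemma fps_factor f : f != 0 -> exists n g h, f = fpsX n * g /\ h * g = 1.
Proof.
move=> /fps_neq0 exf; case: (ex_minnP exf) => n fn minf.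
have [|g fE] := @flow_mulX n f.
  move=> k kn; apply/eqP; apply: contraTT kn => /minf.
  by rewrite -leqNgt.
have [|h gh] := @fps_inverse g; last by exists n, g, h.
by move: fn; rewrite fE fcoefXM leqnn subnn.
Qed.

Lemma fps_split n f :
  exists g, f = \sum_(j < n) (fcoef f j)%:A * fpsX j + fpsX n * g.
Proof.
pose s := \sum_(j < n) (fcoef f j)%:A * fpsX j.
have [|g E] := @flow_mulX n (f - s); last by exists g; rewrite -E addrC subrK.
move=> k kn; rewrite fcoefD fcoefN fcoef_sum (bigD1 (Ordinal kn)) //.
rewrite fcoefAM fcoefX eqxx mulr1 big1 => [|i]; first by rewrite /= addr0 subrr.
rewrite -val_eqE => /negPf ik.
by rewrite fcoefAM fcoefX [k == _]eq_sym ik mulr0.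
Qed.

End PowerSeries.

(** * The conductor *)

Section Conductor.
Variables (F : fieldType) (R : set {fps F}).
Hypothesis R_subalg : GRing.subalg_closed [in R].

Lemma subalg1 : R 1.
Proof. by case: R_subalg; rewrite inE. Qed.

Lemma subalgM f g : R f -> R g -> R (f * g).
Proof.
by case: R_subalg => _ _ RM Rf Rg; have := RM f g; rewrite !inE; apply.
Qed.

Lemma subalgZD x f g : R f -> R g -> R (x *: f + g).
Proof.
by case: R_subalg => _ RZ _ Rf Rg; have := RZ x f g; rewrite !inE; apply.
Qed.

Lemma subalgD f g : R f -> R g -> R (f + g).
Proof. by move=> Rf Rg; rewrite -[f]scale1r; apply: subalgZD. Qed.

Lemma subalg0 : R 0.
Proof. by have := subalgZD (-1) subalg1 subalg1; rewrite scaleN1r addNr. Qed.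

Lemma subalgA x : R x%:A.
Proof. by rewrite -[x%:A]addr0; apply: subalgZD (subalg1) (subalg0). Qed.

Lemma subalgX f n : R f -> R (f ^+ n).
Proof.
move=> Rf; elim: n => [|n IH]; first exact: subalg1.
by rewrite exprS; apply: subalgM.
Qed.

Lemma subalg_sum n (f : 'I_n -> {fps F}) :
  (forall i, R (f i)) -> R (\sum_(i < n) f i).
Proof.
move=> Rf; elim/big_ind: _; [exact: subalg0|exact: subalgD|].
by move=> i _; apply: Rf.
Qed.

Lemma subalg_maxid f : R f -> maxid R (f - (fcoef f 0)%:A).
Proof.
move=> Rf; split; last by rewrite fcoefD fcoefN fcoefZ /= mulr1 subrr.
rewrite addrC -scaleN1r scalerA -[_ *: 1 + _]/(_ *: 1 + f).
by apply: subalgZD => //; exact: subalg1.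
Qed.

Lemma is_maximal_maxid : is_maximal_ideal R (maxid R).
Proof.
split.
- split; first by move=> f [].
  split; first by split; [exact: subalg0|].
    move=> f g [Rf f0] [Rg g0]; split; first exact: subalgD.
    by rewrite fcoefD f0 g0 addr0.
  move=> r f Rr [Rf f0]; split; first exact: (subalgM Rr Rf).
  by rewrite [LHS]fcoefM0 f0 mulr0.
- by case=> _ /eqP; rewrite fcoef1 oner_eq0.
move=> I [IR [I0 ID IM]] I1 mI; apply/seteqP; split=> // f If.
split; first exact: IR.
apply/eqP/negPn/negP => f0; apply: I1.
have Rf := IR _ If.
have If' := mI _ (subalg_maxid Rf).
have IA : I (fcoef f 0)%:A.
  have := ID _ _ If (IM _ _ (subalgA (-1)) If').
  by rewrite -[_ *: (_ - _)]/(_ * _) scaleN1r mulN1r opprB addrC subrK.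
have := IM _ _ (subalgA (fcoef f 0)^-1) IA.
by rewrite -[_ *: _]/(_ * _) mulr_algl scalerA mulVf // scale1r.
Qed.

Lemma ideal_pow_flow n f : ideal_pow R (maxid R) n f -> flow n f.
Proof.
elim: n f => [f _ //|n IH f /=] [k [a [b [am bI ->]]]] i ik.
rewrite fcoef_sum big1 // => j _.
have a1 : flow 1 (a j) by case=> // _; case: (am j).
exact: (flowM a1 (IH _ (bI j))).
Qed.

Lemma ideal_pow_exp n f r :
  maxid R f -> R r -> ideal_pow R (maxid R) n (f ^+ n * r).
Proof.
move=> mf Rr; elim: n => [|n IH]; first by rewrite mul1r.
exists 1%N, (fun=> f), (fun=> f ^+ n * r); split=> //.
by rewrite big_ord1 exprS -mulrA.
Qed.

Hypotheses (R_local : complete_local R) (R_frac : has_full_fraction_field R).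

Lemma maxid_complete : adic_complete R (maxid R).
Proof.
by case: R_local => m [_ uniq cm]; rewrite (uniq _ is_maximal_maxid).
Qed.

Lemma exists_mulX : exists2 g, g != 0 & R g /\ R (fpsX F 1 * g).
Proof.
have [f [g [Rf Rg g0 E]]] := R_frac (FracField.tofrac (fpsX F 1)).
exists g => //; split=> //; suff <- : f = fpsX F 1 * g by [].
have tg0 : FracField.tofrac g != 0 by rewrite tofrac_eq0.
by apply/eqP; rewrite -tofrac_eq tofracM E divfK.
Qed.

(** The elements [z ^ j g ^ n] with [j <= n] replace the [z ^ j] as digits of an
    expansion in powers of [f = z g]; this is where both [g] and [z g] are
    needed in [R]. The sum of the expansion exists in the [m]-adic sense, and
    it is the expected series because [m ^ k] is contained in the series of
    order at least [k]. *)
Lemma conductor : exists2 N, (0 < N)%N & forall h, flow N h -> R h.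
Proof.
have [g g0 [Rg Rzg]] := exists_mulX.
have [n [u [w [gE wu]]]] := fps_factor g0.
pose f := fpsX F 1 * g; pose gam := g ^+ n.
have mf : maxid R f by split=> //; rewrite fcoefXM.
pose p h := \sum_(j < n.+1) (fcoef h j)%:A * fpsX F j.
have step h : exists h', h = p h + f * h'.
  (* [z ^ n.+1 = w f] since [g = z ^ n u] with [u w = 1] *)
  have [h' E] := fps_split n.+1 h; exists (w * h').
  rewrite {1}E; congr (_ + _); rewrite -add1n fpsXD /f gE -!mulrA.
  by do 2 congr (_ * _); rewrite mulrA [u * w]mulrC wu mul1r.
have [next nextE] := choice step.
have Rp h : R (gam * p h).
  rewrite mulr_sumr; apply: subalg_sum => j; rewrite mulrCA.
  apply: subalgM; first exact: subalgA.
  have -> : gam * fpsX F j = f ^+ j * g ^+ (n - j).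
    have jn : (j <= n)%N by rewrite -ltnS.
    rewrite /f /gam exprMn -fpsX_exp mul1n -mulrA -exprD (subnKC jn).
    exact: mulrC.
  by apply: subalgM; apply: subalgX.
suff Rgam h : R (gam * h).
  (* the successor keeps the exponent positive when [n = 0] *)
  exists (n * n).+1 => // h /(fun H k (kn : (k < n * n)%N) => H k (ltnW kn)).
  move=> /flow_mulX[h' ->].
  have -> : fpsX F (n * n)%N * h' = gam * (w ^+ n * h').
    rewrite mulrA; congr (_ * _).
    by rewrite /gam -exprMn gE -mulrA [u * w]mulrC wu mulr1 fpsX_exp.
  exact: Rgam.
pose it k := iter k next h.
pose U k := \sum_(i < k) f ^+ i * (gam * p (it i)).
have UE k : gam * h - U k = f ^+ k * (gam * it k).
  elim: k => [|k IH]; first by rewrite /U big_ord0 subr0 mul1r.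
  rewrite /U big_ord_recr /= opprD addrA IH {1}[it k]nextE -[next _]/(it k.+1).
  rewrite -mulrBr -mulrBr [p _ + _]addrC addrK exprSr -mulrA.
  by rewrite [f * (gam * _)]mulrCA.
have [cm0 cm] := maxid_complete.
have [||r Rr rE] := cm U.
- move=> k; apply: subalg_sum => i; apply: subalgM; last exact: Rp.
  by apply: subalgX; case: mf.
- move=> k; rewrite /U big_ord_recr /= [_ + _ - _]addrC addKr.
  exact: ideal_pow_exp.
suff -> : gam * h = r by [].
apply/eqP; rewrite -subr_eq0; apply/eqP/flow_eq0 => k.
rewrite -[_ - _](subrKA (U k)).
rewrite -[U k - r]opprB; apply: flowB; last exact/ideal_pow_flow.
rewrite UE mulrC; apply: flowMl; apply: flow_exp.
by case=> // _; case: mf.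
Qed.

End Conductor.

(** * Vectors as sequences of scalars *)

Section Orders.
Variables (F : fieldType) (c : nat).
Notation V := 'rV[{fps F}]_c.+1.
Implicit Types (u v w : V) (x y : F) (f : {fps F}) (M A : set V).

(** The coefficient of the monomial [z ^ n e_i], at the index [k = n c.+1 + i]
    which is its rank for the valuation. *)
Definition cf v k : F := fcoef (v 0 (inord (k %% c.+1))) (k %/ c.+1).

Lemma cf_entry v (i : 'I_c.+1) n : cf v (n * c.+1 + i) = fcoef (v 0 i) n.
Proof.
by rewrite /cf divnMDl // divn_small // addn0 modnMDl modn_small // inord_val.
Qed.

Lemma cfD u v k : cf (u + v) k = cf u k + cf v k.
Proof. by rewrite /cf mxE. Qed.

Lemma cf0 k : cf 0 k = 0.
Proof. by rewrite /cf mxE. Qed.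

Lemma cfN v k : cf (- v) k = - cf v k.
Proof. by rewrite /cf mxE. Qed.

Lemma cfB u v k : cf (u - v) k = cf u k - cf v k.
Proof. by rewrite cfD cfN. Qed.

Lemma cf_sum (I : Type) (r : seq I) (P : pred I) (e : I -> V) k :
  cf (\sum_(i <- r | P i) e i) k = \sum_(i <- r | P i) cf (e i) k.
Proof.
by apply: (big_morph (fun v => cf v k)) => [u v|]; rewrite (cfD, cf0).
Qed.

Lemma cfA x v k : cf (x%:A *: v) k = x * cf v k.
Proof. by rewrite /cf mxE fcoefAM. Qed.

Lemma cfX n v k : cf (fpsX F n *: v) k =
  if (n * c.+1 <= k)%N then cf v (k - n * c.+1)%N else 0.
Proof.
rewrite /cf mxE fcoefXM leq_divRL //; case: leqP => // nk.
rewrite -[in LHS](subnK nk) addnC modnMDl divnMDl //; congr (fcoef (v _ _) _).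
by rewrite addKn.
Qed.

Lemma cf_scale f v k :
  cf (f *: v) k = \sum_(i < (k %/ c.+1).+1) fcoef f i * cf v (k - i * c.+1)%N.
Proof.
rewrite /cf mxE fcoefM; apply: eq_bigr => i _; congr (_ * _).
have ik : (i * c.+1 <= k)%N by rewrite -leq_divRL // -ltnS.
have E : k = (i * c.+1 + (k - i * c.+1))%N by rewrite subnKC.
by rewrite {1 2}E modnMDl divnMDl // addKn.
Qed.

Lemma cf_eq0 v : (forall k, cf v k = 0) -> v = 0.
Proof.
move=> v0; apply/rowP => i; rewrite mxE; apply: fpsP => n.
by rewrite -cf_entry v0.
Qed.

(** As an [F]-subspace of [Omega], [low (N * c.+1)] is [z ^ N Omega]. *)
Definition low n v := forall k, (k < n)%N -> cf v k = 0.

Lemma low_leq m n v : (m <= n)%N -> low n v -> low m v.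
Proof. by move=> mn vn k km; apply/vn/(leq_trans km). Qed.

Lemma low0 n : low n 0.
Proof. by move=> k _; rewrite cf0. Qed.

Lemma lowD n u v : low n u -> low n v -> low n (u + v).
Proof. by move=> un vn k kn; rewrite cfD un // vn // addr0. Qed.

Lemma lowA n x v : low n v -> low n (x%:A *: v).
Proof. by move=> vn k kn; rewrite cfA vn // mulr0. Qed.

Lemma lowN n v : low n v -> low n (- v).
Proof. by move=> vn k kn; rewrite cfN vn // oppr0. Qed.

Lemma low_sum n m (e : 'I_m -> V) :
  (forall i, low n (e i)) -> low n (\sum_(i < m) e i).
Proof.
move=> en; elim/big_ind: _ => [|u v|i _]; [exact: low0|exact: lowD|].
exact: en.
Qed.

Lemma low_scale n f v : low n v -> low n (f *: v).
Proof.
move=> vn k kn; rewrite cf_scale big1 // => i _.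
by rewrite vn ?mulr0 //; apply: leq_ltn_trans (leq_subr _ _) kn.
Qed.

Lemma low_scale_max n f v :
  fcoef f 0 = 0 -> low n v -> low (n + c.+1)%N (f *: v).
Proof.
move=> f0 vn; have [|g ->] := @flow_mulX _ 1 f; first by case.
move=> k kn; rewrite -scalerA cfX mul1n; case: leqP => // ck.
by apply: low_scale vn _ _; lia.
Qed.

Lemma low_mulX n v : low (n * c.+1) v -> exists u, v = fpsX F n *: u.
Proof.
move=> vn.
have H (i : 'I_c.+1) : exists g, v 0 i = fpsX F n * g.
  apply: flow_mulX => k kn; rewrite -cf_entry; apply: vn.
  have := ltn_ord i; nia.
have [g gE] := choice H; exists (\row_i g i).
by apply/rowP => i; rewrite !mxE gE.
Qed.

Definition isord v n := cf v n != 0 /\ low n v.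

Lemma exists_isord v : v != 0 -> exists n, isord v n.
Proof.
move=> v0; have exv : exists k, cf v k != 0.
  apply: contrapT => nex; case/eqP: v0; apply: cf_eq0 => k.
  by apply/eqP/negPn/negP => vk; apply: nex; exists k.
case: (ex_minnP exv) => n vn minv; exists n; split=> // k kn.
by apply/eqP; apply: contraTT kn => /minv; rewrite -leqNgt.
Qed.

Lemma isord_neq0 v n : isord v n -> v != 0.
Proof. by case=> vn _; apply: contraNneq vn => ->; rewrite cf0. Qed.

Lemma isordD v u n : isord v n -> low n.+1 u -> isord (v + u) n.
Proof.
move=> [vn ln] un; split; first by rewrite cfD un // addr0.
by apply: lowD => //; apply: low_leq un.
Qed.

Lemma isordA x v n : x != 0 -> isord v n -> isord (x%:A *: v) n.
Proof.
by move=> x0 [vn ln]; split; [rewrite cfA mulf_neq0|apply: lowA].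
Qed.

Lemma isordX v n m : isord v n -> isord (fpsX F m *: v) (m * c.+1 + n).
Proof.
move=> [vn ln]; split; first by rewrite cfX leq_addr addKn.
by move=> k kn; rewrite cfX; case: leqP => // mk; rewrite ln //; lia.
Qed.

Lemma isord_low v n k : isord v n -> (k <= n)%N -> low k v.
Proof. by case=> _ ln kn; apply: low_leq ln. Qed.

(** The set [Delta M] with its values replaced by their ranks, see
    [Delta_ords]. *)
Definition ords M : set nat := [set n | exists2 v, M v & isord v n].

Definition subspace M := is_submod (range (fun x : F => x%:A)) M.

Section Subspace.
Variable M : set V.
Hypothesis M_sub : subspace M.

Lemma subspace0 : M 0. Proof. by case: M_sub. Qed.

Lemma subspaceD u v : M u -> M v -> M (u + v).
Proof. by case: M_sub => _ + _; apply. Qed.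

Lemma subspaceA x v : M v -> M (x%:A *: v).
Proof. by case: M_sub => _ _ + Mv; apply=> //; exists x. Qed.

Lemma subspaceN v : M v -> M (- v).
Proof. by move/(subspaceA (-1)); rewrite !scaleN1r. Qed.

Lemma subspaceB u v : M u -> M v -> M (u - v).
Proof. by move=> Mu /subspaceN; apply: subspaceD. Qed.

Lemma subspace_sum n (e : 'I_n -> V) :
  (forall i, M (e i)) -> M (\sum_(i < n) e i).
Proof.
move=> Me; elim/big_ind: _; [exact: subspace0|exact: subspaceD|].
by move=> i _; apply: Me.
Qed.

Lemma subspaceBr u v : M v -> M (u - v) -> M u.
Proof. by move=> Mv /subspaceD /(_ Mv); rewrite subrK. Qed.

End Subspace.

Lemma ords_sub M A : M `<=` A -> ords M `<=` ords A.
Proof. by move=> MA n [v Mv vn]; exists v => //; apply: MA. Qed.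

Lemma isord_cancel u v n : low n u -> isord v n ->
  exists x, low n.+1 (u - x%:A *: v).
Proof.
move=> un [vn ln]; exists (cf u n / cf v n) => k; rewrite ltnS leq_eqVlt.
case/orP => [/eqP ->|kn]; rewrite cfB cfA; first by rewrite divfK ?subrr.
by rewrite (un k kn) (ln k kn) mulr0 subr0.
Qed.

(** Leading terms at one index differ by a scalar, so a vector of [M] can be
    reduced by vectors of [A], raising its order each time; after finitely many
    steps it is in [low B]. *)
Lemma ords_mem (M A : set V) B n w : subspace M -> subspace A -> A `<=` M ->
  low B `<=` A -> (forall k, (n <= k)%N -> ords M k -> ords A k) ->
  M w -> low n w -> A w.
Proof.
move=> Ms As AM AB; elim: {n}(B - n)%N {-2}n (leqnn (B - n)) w
  => [|d IH] n dn w H Mw wn.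
  by apply: AB; apply: low_leq wn; lia.
case: (eqVneq (cf w n) 0) => [w0|w0].
  apply: (IH n.+1) => //; first by lia.
    by move=> k /ltnW; apply: H.
  by move=> k; rewrite ltnS leq_eqVlt => /orP[/eqP ->|/wn].
have [v Av vn] : ords A n by apply: H => //; exists w.
have [x xE] := isord_cancel wn vn.
apply: (subspaceBr As (subspaceA As x Av)); apply: (IH n.+1) => //.
  by lia.
  by move=> k /ltnW; apply: H.
by apply: (subspaceB Ms Mw); apply: (subspaceA Ms); apply: AM.
Qed.

Section Basis.
Variables (M A : set V) (B r : nat) (idx : 'I_r -> nat) (e : 'I_r -> V).
Hypotheses (Ms : subspace M) (As : subspace A) (AM : A `<=` M).
Hypothesis AB : low B `<=` A.
Hypotheses (idx_inj : injective idx) (Me : forall k, M (e k)).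
Hypotheses (ord_e : forall k, isord (e k) (idx k)).
Hypotheses (A_idx : forall k, ~ ords A (idx k)).

Notation comb y := (\sum_(k < r) (y k)%:A *: e k).

(** The orders [idx k] being distinct, the term of least order among those with
    a nonzero coefficient cannot be cancelled. *)
Lemma comb_low (y : {ffun 'I_r -> F}) : y != 0 ->
  exists2 k, y k != 0 & isord (comb y) (idx k).
Proof.
move=> y0; have [k0 yk0] : exists k, y k != 0.
  apply: contrapT => nex; case/eqP: y0; apply/ffunP => k; rewrite ffunE.
  by apply/eqP/negPn/negP => yk; apply: nex; exists k.
case: (@arg_minnP _ k0 (fun k => y k != 0) idx yk0) => k yk mink.
exists k => //; rewrite (bigD1 k) //=; apply: isordD; first exact: isordA.
move=> m mk; rewrite cf_sum big1 // => i ik; rewrite cfA.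
have [->|yi] := eqVneq (y i) 0; first by rewrite mul0r.
have lt_ki : (idx k < idx i)%N.
  by rewrite ltn_neqAle mink // andbT (inj_eq idx_inj) eq_sym.
by case: (ord_e i) => _ ->; rewrite ?mulr0 // (leq_trans mk).
Qed.

Lemma comb_free (y : {ffun 'I_r -> F}) : A (comb y) -> y = 0.
Proof.
move=> Ay; apply/eqP/negPn/negP => /comb_low[k _ ko].
by apply: (A_idx (k := k)); exists (comb y).
Qed.

(** The subspace [A + span e], written with coordinates along [e] because
    [has_dimq] is. *)
Definition span_mod : set V :=
  [set w | exists y : {ffun 'I_r -> F}, A (w - comb y)].

Lemma subspace_span_mod : subspace span_mod.
Proof.
split.
- exists 0; rewrite big1 ?subrr => [|k _]; first exact: subspace0.
  by rewrite ffunE !scale0r.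
- move=> u v [y Ay] [z Az]; exists (y + z).
  rewrite (_ : _ - _ = (u - comb y) + (v - comb z)); first exact: subspaceD.
  rewrite addrACA -opprD -big_split; congr (_ - _); apply: eq_bigr => k _.
  by rewrite ffunE !scalerDl.
- move=> _ v [x _ <-] [y Ay]; exists [ffun k => x * y k].
  rewrite (_ : _ - _ = x%:A *: (v - comb y)); first exact: subspaceA.
  rewrite scalerBr scaler_sumr; congr (_ - _); apply: eq_bigr => k _.
  by rewrite ffunE scalerA mulr_algl scalerA.
Qed.

Lemma sub_span_mod : A `<=` span_mod.
Proof.
move=> v Av; exists 0; rewrite big1 ?subr0 // => k _.
by rewrite ffunE !scale0r.
Qed.

Lemma mem_span_mod i : span_mod (e i).
Proof.
exists [ffun j => (j == i)%:R]; rewrite (bigD1 i) //= ffunE eqxx !scale1r.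
rewrite big1 ?addr0 ?subrr => [|j /negPf ji]; first exact: subspace0.
by rewrite ffunE ji !scale0r.
Qed.

Lemma span_mod_sub : span_mod `<=` M.
Proof.
move=> v [y /AM Ay]; apply: (subspaceBr Ms _ Ay); apply: (subspace_sum Ms) => k.
exact: (subspaceA Ms).
Qed.

Lemma comb_span : (forall k, ords M k -> ords A k \/ exists i, idx i = k) ->
  M `<=` span_mod.
Proof.
move=> H w Mw; apply: (@ords_mem M span_mod B 0) => //.
- exact: subspace_span_mod.
- exact: span_mod_sub.
- by move=> v /AB; apply: sub_span_mod.
move=> k _ Mk; case: (H k Mk) => [|[i ik]].
  exact: (ords_sub sub_span_mod).
by exists (e i); [exact: mem_span_mod|rewrite -ik].
Qed.

Lemma comb_dimq : (forall k, ords M k -> ords A k \/ exists i, idx i = k) ->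
  has_dimq M A r.
Proof.
move=> H; exists e; split=> // v Mv.
have [y Ay] := comb_span H Mv.
exists y; split=> // z Az; apply/eqP; rewrite -subr_eq0; apply/eqP/comb_free.
have -> : comb (y - z) = (v - comb z) - (v - comb y).
  rewrite opprB [RHS]addrC addrA subrK -sumrB; apply: eq_bigr => k _.
  by rewrite !ffunE !scalerBl.
exact: subspaceB.
Qed.

End Basis.
End Orders.

(** Taking coordinates along one basis of the combinations of the other is an
    injection from [F ^ n] to [F ^ m], and [F] is finite. *)
Lemma has_dimq_inj (F : finFieldType) (c : nat)
    (M A : set 'rV[{fps F}]_c.+1) m n :
  subspace M -> subspace A -> has_dimq M A m -> has_dimq M A n -> m = n.
Proof.
move=> Ms As; wlog: m n / (m <= n)%N.
  move=> W; case: (leqP m n) => [|/ltnW] mn Hm Hn; first exact: W.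
  by apply/esym; apply: W.
move=> mn [e [Me eP]] [d [Md dP]]; apply/eqP; rewrite eqn_leq mn /=.
pose comb (y : {ffun 'I_n -> F}) := \sum_(k < n) (y k)%:A *: d k.
have Mcomb y : M (comb y).
  by apply: subspace_sum => // k; apply: subspaceA.
have [g gP] := choice (fun y => eP (comb y) (Mcomb y)).
suff : injective g.
  move/leq_card; rewrite !card_ffun !card_ord leq_exp2l //.
  exact: card_finNzRing_gt1.
move=> y z yz.
have [t [_ tP]] := dP _ (Mcomb y).
rewrite -(tP y); last by rewrite subrr; exact: subspace0.
apply: tP; have [Ay _] := gP y; have [Az _] := gP z.
rewrite -/(comb z) -[comb y - _](subrKA (\sum_(k < m) (g y k)%:A *: e k)).
apply: (subspaceD As Ay); rewrite -opprB yz.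
exact: (subspaceN As Az).
Qed.

Lemma dimqE (F : finFieldType) (c : nat) (M A : set 'rV[{fps F}]_c.+1) n :
  subspace M -> subspace A -> has_dimq M A n -> dimq M A = n.
Proof.
move=> Ms As H; apply: (has_dimq_inj Ms As _ H).
exact: (xgetI 0%N H).
Qed.

(** * Standard modules *)

Section Products.
Variables (F : fieldType) (c : nat).
Notation V := 'rV[{fps F}]_c.+1.
Implicit Types (u v w : V) (x : F) (I R : set {fps F}) (M : set V).

Lemma smul_mem I M f v : I f -> M v -> smul I M (f *: v).
Proof.
by move=> If Mv; exists 1%N, (fun=> f), (fun=> v); rewrite big_ord1.
Qed.

Lemma smulD I M u v : smul I M u -> smul I M v -> smul I M (u + v).
Proof.
move=> [m [f [a [If Ma ->]]]] [n [g [b [Ig Mb ->]]]].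
exists (m + n)%N.
exists (fun k => match fintype.split k with inl i => f i | inr j => g j end).
exists (fun k => match fintype.split k with inl i => a i | inr j => b j end).
split; try by move=> k; case: fintype.split.
rewrite big_split_ord; congr (_ + _); apply: eq_bigr => i _.
  by rewrite (unsplitK (inl i : 'I_m + 'I_n)).
by rewrite (unsplitK (inr i : 'I_m + 'I_n)).
Qed.

Lemma subspace_smul I M : subspace M -> subspace (smul I M).
Proof.
move=> Ms; split.
- by exists 0%N, (fun=> 0), (fun=> 0); rewrite big_ord0; split=> // -[].
- by move=> u v; apply: smulD.
move=> _ _ [x _ <-] [n [f [v [If Mv ->]]]].
exists n, f, (fun k => x%:A *: v k); split=> // [k|].
  exact: subspaceA.
by rewrite scaler_sumr; apply: eq_bigr => k _; rewrite !scalerA mulrC.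
Qed.

Lemma smul_ind I M (P : set V) : subspace P ->
  (forall f v, I f -> M v -> P (f *: v)) -> smul I M `<=` P.
Proof.
move=> Ps H _ [n [f [v [If Mv ->]]]]; apply: (subspace_sum Ps) => k.
exact: H.
Qed.

Lemma smul_setS I M M' : M `<=` M' -> smul I M `<=` smul I M'.
Proof.
move=> MM' _ [n [f [v [If Mv ->]]]]; exists n, f, v; split=> // k.
exact: MM'.
Qed.

Lemma isord_delta (i : 'I_c.+1) : isord (delta_mx 0 i : V) i.
Proof.
have E k : (k < c.+1)%N -> cf (delta_mx 0 i : V) k = (k == i)%:R.
  move=> kc; have E : (inord k == i) = (k == i).
    by rewrite -(inj_eq val_inj) /= inordK.
  rewrite /cf modn_small // divn_small // mxE eqxx E.
  by case: (k == i).
by split=> [|k ki]; rewrite E ?eqxx ?oner_neq0 ?ltn_eqF // (ltn_trans ki).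
Qed.

End Products.

Section Lattices.
Variables (F : fieldType) (R : set {fps F}) (c N : nat).
Notation V := 'rV[{fps F}]_c.+1.
Implicit Types (u v w : V) (x : F) (f r : {fps F}) (M : set V).
Hypotheses (R_subalg : GRing.subalg_closed [in R]) (N_gt0 : (0 < N)%N).
Hypothesis R_cond : forall h, flow N h -> R h.
Local Notation B := (N * c.+1)%N.
Local Notation mx M := (smul (maxid R) M).

Lemma submod_subspace M : is_submod R M -> subspace M.
Proof.
case=> M0 MD MZ; split=> // _ v [x _ <-]; apply: MZ.
exact: subalgA.
Qed.

(** Because [R] is the sum of the constants and of its maximal ideal. *)
Lemma subspace_submod M :
  subspace M -> (forall f v, maxid R f -> M v -> M (f *: v)) -> is_submod R M.
Proof.
move=> Ms Mm; split; [exact: subspace0|exact: subspaceD|move=> r v Rr Mv].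
rewrite -[r](subrK (fcoef r 0)%:A) scalerDl; apply: (subspaceD Ms).
  by apply: Mm => //; apply: subalg_maxid.
exact: subspaceA.
Qed.

Lemma smul_maxid_sub M : is_submod R M -> mx M `<=` M.
Proof.
move=> MR; apply: smul_ind => [|f v [Rf _] Mv]; first exact: submod_subspace.
by case: MR => _ _; apply.
Qed.

Lemma ords_smul_maxid_gt M k : ords (mx M) k -> (c < k)%N.
Proof.
case=> w mw [wk _]; rewrite ltnNge; apply/negP => kc; case/eqP: wk.
suff mlow : mx M `<=` low c.+1 by apply: mlow mw _ _.
apply: smul_ind => [|f v [_ f0] _].
  split; [exact: low0|by move=> *; apply: lowD|].
  by move=> _ v [x _ <-]; apply: lowA.
exact: (@low_scale_max _ _ 0).
Qed.

Section Standard.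
Variable M : set V.
Hypothesis M_std : standard R M.

Lemma standard_submod : is_submod R M. Proof. by case: M_std. Qed.

Lemma standard_subspace : subspace M.
Proof. exact/submod_subspace/standard_submod. Qed.

(** [z ^ N Omega = z ^ N O M], and [z ^ N O] is contained in the maximal ideal
    because [N] is positive. *)
Lemma standard_low : low B `<=` mx M.
Proof.
move=> w /low_mulX[u ->].
have : smul setT M u by case: M_std => _ ->.
case=> n [f [v [_ Mv ->]]]; exists n, (fun k => fpsX F N * f k), v.
split=> // [k|]; last first.
  by rewrite scaler_sumr; apply: eq_bigr => k _; rewrite scalerA.
split; first by apply: R_cond; apply: flowMX.
by rewrite fcoefM0 fcoefX eq_sym gtn_eqF // mul0r.
Qed.

Lemma standard_lowM : low B `<=` M.
Proof. by move=> w /standard_low; apply: smul_maxid_sub standard_submod _. Qed.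

(** In an expression of [e_k] as a sum of multiples of elements of [M], keeping
    only the constant terms of the multipliers changes nothing modulo
    [z Omega]. *)
Lemma standard_ords k : (k <= c)%N -> ords M k.
Proof.
move=> kc; pose d : V := delta_mx 0 (Ordinal (kc : (k < c.+1)%N)).
have : smul setT M d by case: M_std => _ ->.
case=> n [f [v [_ Mv dE]]]; exists (\sum_(i < n) (fcoef (f i) 0)%:A *: v i).
  apply: (subspace_sum standard_subspace) => i.
  exact: (subspaceA standard_subspace).
have -> : \sum_(i < n) (fcoef (f i) 0)%:A *: v i =
    d + \sum_(i < n) ((fcoef (f i) 0)%:A - f i) *: v i.
  rewrite dE -big_split /=; apply: eq_bigr => i _.
  by rewrite -scalerDl addrC subrK.
apply: isordD; first exact: isord_delta.
apply: low_sum => i; apply: (@low_leq _ _ _ (0 + c.+1)).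
  by rewrite add0n ltnS.
apply: low_scale_max => //.
by rewrite fcoefD fcoefN fcoefZ fcoef1 eqxx mulr1 subrr.
Qed.

End Standard.

(** Multiplying by powers of [z] the vectors of [M] of order at most [c] gives
    vectors of every order in [O M]. *)
Lemma ords_standard M n : is_submod R M -> low n `<=` M ->
  (forall k, (k <= c)%N -> ords M k) -> standard R M.
Proof.
move=> MR Mn Mk; split=> //; apply/seteqP; split=> // w _.
have Ms := submod_subspace MR.
have MO : M `<=` smul setT M.
  by move=> v Mv; rewrite -[v]scale1r; apply: smul_mem.
apply: (@ords_mem _ _ setT (smul setT M) n 0) => //.
- exact: subspace_smul.
- by move=> v /Mn/MO.
move=> k _ _; have [|v Mv vk] := Mk (k %% c.+1)%N.
  by rewrite -ltnS ltn_pmod.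
exists (fpsX F (k %/ c.+1)%N *: v); first exact: smul_mem.
by rewrite {2}(divn_eq k c.+1); apply: isordX.
Qed.

Lemma standard_sup M M' :
  standard R M -> is_submod R M' -> M `<=` M' -> standard R M'.
Proof.
move=> [_ MO] M'R MM'; split=> //; apply/seteqP; split=> // w _.
by apply: smul_setS MM' _ _; rewrite MO.
Qed.

(** * Modules with one leading term removed *)

(** Vectors of [M] of these orders form a basis of [M / m M]. *)
Definition jump M n := ords M n /\ ~ ords (mx M) n.

(** A step of a flag, with [b] the index removed. All the modules of a standard
    flag are standard, since they contain the first one. *)
Definition hyper M M' b :=
  [/\ standard R M', M' `<=` M, ~ ords M' b & ords M = ords M' `|` [set b]].

Section Hyper.
Variables (M M' : set V) (b : nat).
Hypotheses (M_std : standard R M) (MM' : hyper M M' b).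

Let Ms := standard_subspace M_std.
Let M's : subspace M'. Proof. by case: MM' => /standard_subspace. Qed.
Let M'M : M' `<=` M. Proof. by case: MM'. Qed.
Let M'B : low B `<=` M'. Proof. by case: MM' => /standard_lowM. Qed.

Lemma hyper_ords_neq n : n <> b -> ords M n -> ords M' n.
Proof. by move=> nb; case: MM' => _ _ _ -> []. Qed.

Lemma hyper_ords : ords M b.
Proof. by case: MM' => _ _ _ ->; right. Qed.

Lemma hyper_low w : M w -> low b.+1 w -> M' w.
Proof.
move=> Mw wb; apply: (ords_mem Ms M's M'M M'B _ Mw wb) => k bk.
by apply: hyper_ords_neq => kb; rewrite kb ltnn in bk.
Qed.

Lemma hyper_split v w : M v -> isord v b -> M w -> exists x, M' (w - x%:A *: v).
Proof.
move=> Mv vb Mw.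
have [] := @comb_span _ _ M M' B 1 (fun=> b) (fun=> v) Ms M's M'M M'B
  _ _ _ w Mw => //.
  move=> k Mk; case: (pselect (k = b)) => [->|kb]; first by right; exists ord0.
  by left; apply: hyper_ords_neq.
by move=> y; rewrite big_ord1; exists (y ord0).
Qed.

Lemma hyper_dimq : has_dimq M M' 1.
Proof.
have [v Mv vb] := hyper_ords.
apply: (@comb_dimq _ _ M M' B 1 (fun=> b) (fun=> v)) => //.
- by move=> i j _; rewrite !ord1.
- by move=> _; case: MM'.
move=> k Mk; case: (pselect (k = b)) => [->|kb]; first by right; exists ord0.
by left; apply: hyper_ords_neq.
Qed.

(** Multiplication by the maximal ideal raises the order, above [b] where [M]
    and [M'] agree. *)
Lemma hyper_maxid_low f v : maxid R f -> M v -> low b v -> M' (f *: v).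
Proof.
move=> [Rf f0] Mv vb; apply: hyper_low.
  by case: (standard_submod M_std) => _ _; apply.
by apply: (low_leq _ (low_scale_max f0 vb)); rewrite addnS ltnS leq_addr.
Qed.

(** Since [M = M' + F v] with [v] of order [b], the products [f *: w] are sums
    of a product in [M'] and a multiple of [f *: v], of order above [b]. *)
Lemma hyper_maxid : mx M `<=` M'.
Proof.
apply: (smul_ind M's) => f w mf Mw.
have [v Mv vb] := hyper_ords; have [x M'w] := hyper_split Mv vb Mw.
rewrite -[w](subrK (x%:A *: v)) scalerDr; apply: (subspaceD M's).
  by case: MM' => -[[_ _ M'R] _] _ _ _; apply: M'R => //; case: mf.
by apply: hyper_maxid_low => //; [apply: (subspaceA Ms)|apply: lowA; case: vb].
Qed.

Lemma hyper_jump : jump M b.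
Proof.
split; first exact: hyper_ords.
case: MM' => _ _ + _ => nb mb; apply: nb; apply: ords_sub mb.
exact: hyper_maxid.
Qed.

Lemma hyper_gt : (c < b)%N.
Proof.
case: MM' => M'std _ nb _; rewrite ltnNge; apply/negP.
by move/(standard_ords M'std).
Qed.

(** [m M] and [m M'] may differ, but since [M = M' + F v] with [v] of order [b],
    every element of [m M] agrees with one of [m M'] up to index [b]. *)
Lemma hyper_jump_lt n : (n < b)%N -> jump M' n <-> jump M n.
Proof.
move=> nb; have n'b : n <> b by move=> E; rewrite E ltnn in nb.
have EM : ords M' n <-> ords M n.
  by split; [apply: ords_sub|apply: hyper_ords_neq].
have EmM : ords (mx M') n <-> ords (mx M) n.
  split; first by apply: ords_sub; apply: smul_setS.
  pose P : set V := [set w | exists2 w', mx M' w' & low b (w' - w)].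
  suff mP : mx M `<=` P.
    case=> w /mP[w' mw' ww'] wn; exists w' => //; rewrite -[w'](subrK w) addrC.
    by apply: isordD wn _; apply: low_leq ww'.
  apply: smul_ind.
    split.
    - exists 0; last by rewrite subrr; apply: low0.
      exact: (subspace0 (subspace_smul _ M's)).
    - move=> u v [u' mu' uu'] [v' mv' vv']; exists (u' + v').
        exact: smulD.
      by rewrite opprD addrACA; apply: lowD.
    - move=> _ v [x _ <-] [v' mv' vv']; exists (x%:A *: v').
        exact: (subspaceA (subspace_smul _ M's)).
      by rewrite -scalerBr; apply: lowA.
  move=> f w mf Mw; have [v Mv vb] := hyper_ords.
  have [x M'w] := hyper_split Mv vb Mw; exists (f *: (w - x%:A *: v)).
    exact: smul_mem.
  rewrite -scalerBr [w - _]addrC addrK; apply: low_scale.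
  by apply: lowN; apply: lowA; case: vb.
by rewrite /jump EM; split=> -[? H]; split=> // /EmM.
Qed.

End Hyper.

Definition jumps M b := [seq n <- iota 0 b | `[< jump M n >]].

Lemma mem_jumps M b n : (n \in jumps M b) = (n < b)%N && `[< jump M n >].
Proof. by rewrite mem_filter mem_iota andbC. Qed.

Section Count.
Variables (M : set V) (b : nat).
Hypotheses (M_std : standard R M) (cb : (c < b)%N) (Mb : jump M b).

Let Ms := standard_subspace M_std.
Let mMs : subspace (mx M) := subspace_smul _ Ms.
Let mMM : mx M `<=` M := smul_maxid_sub (standard_submod M_std).
Local Notation r := (size (jumps M b)).

(** [m M] plus the vectors of [M] of order above [b]: the part common to all
    the modules obtained from [M] by removing the leading term at [b]. *)
Definition above : set V :=
  [set w | exists u, [/\ mx M u, M (w - u) & low b.+1 (w - u)]].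

Lemma subspace_above : subspace above.
Proof.
split.
- exists 0; rewrite subrr.
  by split; [exact: subspace0|exact: subspace0|exact: low0].
- move=> u v [u' [mu Mu lu]] [v' [mv Mv lv]]; exists (u' + v').
  rewrite opprD addrACA; split; first exact: smulD.
    exact: (subspaceD Ms).
  exact: lowD.
- move=> _ v [x _ <-] [u [mu Mu lu]]; exists (x%:A *: u).
  by rewrite -scalerBr; split; [exact: subspaceA|exact: subspaceA|exact: lowA].
Qed.

Lemma above_sub : above `<=` M.
Proof.
by move=> w [u [mu Mwu _]]; apply: (subspaceBr Ms _ Mwu); apply: mMM.
Qed.

Lemma smul_above : mx M `<=` above.
Proof.
move=> u mu; exists u; rewrite subrr.
by split=> //; [exact: subspace0|exact: low0].
Qed.

Lemma above_low : low B `<=` above.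
Proof. by move=> w wB; apply: smul_above; apply: (standard_low M_std). Qed.

Lemma ords_above_gt n : (b < n)%N -> ords M n -> ords above n.
Proof.
move=> bn [v Mv vn]; exists v => //; exists 0; rewrite subr0.
by split; [exact: subspace0| |apply: isord_low vn _].
Qed.

Lemma ords_above_le n : (n <= b)%N -> ords above n -> ords (mx M) n.
Proof.
move=> nb [w [u [mu Mwu lwu]] wn]; exists u => //.
rewrite -[u](subrK w) addrC; apply: isordD wn _.
by rewrite -opprB; apply: lowN; apply: low_leq lwu.
Qed.

Lemma jump_above n : (n <= b)%N -> jump M n -> ~ ords above n.
Proof. by move=> nb [_ nm] /(ords_above_le nb). Qed.

Lemma exists_jump_basis : exists (idx : 'I_r -> nat) (e : 'I_r -> V),
  [/\ injective idx, forall k, M (e k) /\ isord (e k) (idx k),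
     forall k, (idx k < b)%N /\ jump M (idx k)
   & forall n, (n < b)%N -> jump M n -> exists k, idx k = n].
Proof.
pose idx (k : 'I_r) := nth 0%N (jumps M b) k.
have idxP k : (idx k < b)%N /\ jump M (idx k).
  have : idx k \in jumps M b by apply: mem_nth.
  by rewrite mem_jumps => /andP[? /asboolP].
have eP k : exists v, M v /\ isord v (idx k).
  by have [_ [[v Mv vk] _]] := idxP k; exists v.
have [e {}eP] := choice eP.
exists idx, e; split=> // [i j /eqP|n nb nJ].
  by rewrite nth_uniq ?filter_uniq ?iota_uniq // => /eqP/val_inj.
have nj : n \in jumps M b by rewrite mem_jumps nb; apply/asboolP.
have nr : (index n (jumps M b) < r)%N by rewrite index_mem.
by exists (Ordinal nr); rewrite /idx /= nth_index.
Qed.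

Section Family.
Variables (idx : 'I_r -> nat) (e : 'I_r -> V) (vb : V).
Hypotheses (idx_inj : injective idx) (Me : forall k, M (e k)).
Hypothesis e_ord : forall k, isord (e k) (idx k).
Hypothesis idx_lt : forall k, (idx k < b)%N.
Hypotheses (idx_jump : forall k, jump M (idx k)).
Hypothesis idx_surj : forall n, (n < b)%N -> jump M n -> exists k, idx k = n.
Hypotheses (Mvb : M vb) (vb_ord : isord vb b).
Implicit Types y z : {ffun 'I_r -> F}.

(** Modulo [above], the vectors [e k] and [vb] form a basis of [M]. The
    complements of the line of [vb] are the graphs of the linear functions
    [e k |-> - y k vb]. *)
Definition tilt y k := e k - (y k)%:A *: vb.
Definition graph y := span_mod above (tilt y).

Lemma M_tilt y k : M (tilt y k).
Proof. by apply: (subspaceB Ms) => //; apply: (subspaceA Ms). Qed.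

Lemma tilt_ord y k : isord (tilt y k) (idx k).
Proof.
apply: isordD => //; apply: lowN; apply: lowA.
exact: (isord_low vb_ord (idx_lt k)).
Qed.

Lemma idx_above k : ~ ords above (idx k).
Proof. exact: (jump_above (ltnW (idx_lt k)) (idx_jump k)). Qed.

Lemma graph_subspace y : subspace (graph y).
Proof. exact: (subspace_span_mod _ subspace_above). Qed.

Lemma above_graph y : above `<=` graph y.
Proof. exact: sub_span_mod. Qed.

Lemma tilt_graph y k : graph y (tilt y k).
Proof. exact: (mem_span_mod _ subspace_above). Qed.

Lemma graph_sub y : graph y `<=` M.
Proof. exact: (span_mod_sub Ms above_sub (M_tilt y)). Qed.

(** An element of [graph y] outside [above] has order some [idx k], below [b];
    and [b], being a jump, is not an order of [above]. *)
Lemma graph_ords_b y : ~ ords (graph y) b.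
Proof.
case=> w [z Aw] wb; have [z0|z0] := eqVneq z 0.
  apply: (jump_above (leqnn b) Mb); exists w => //.
  by move: Aw; rewrite z0 big1 ?subr0 // => k _; rewrite ffunE !scale0r.
have [k _ [ck lk]] := comb_low idx_inj (tilt_ord y) z0.
apply: (idx_above (k := k)).
exists (w - \sum_(k < r) (z k)%:A *: tilt y k) => //.
rewrite addrC; apply: isordD; last exact: (isord_low wb (idx_lt k)).
by split; [rewrite cfN oppr_eq0|apply: lowN].
Qed.

Lemma graph_ords y : ords M = ords (graph y) `|` [set b].
Proof.
apply/seteqP; split=> n; last first.
  by case=> [|->]; [apply: ords_sub; apply: graph_sub|case: Mb].
move=> Mn; case: (ltngtP n b) => [nb|bn|->]; last by right.
  left; case: (pselect (ords (mx M) n)) => [|nm].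
    by apply: ords_sub => w /smul_above; apply: above_graph.
  have [k <-] := idx_surj nb (conj Mn nm).
  by exists (tilt y k); [apply: tilt_graph|apply: tilt_ord].
by left; apply: (ords_sub (above_graph y)); apply: ords_above_gt.
Qed.

Lemma hyper_graph y : hyper M (graph y) b.
Proof.
split; [|exact: graph_sub|exact: graph_ords_b|exact: graph_ords].
apply: (@ords_standard _ B).
- apply: (subspace_submod (graph_subspace y)) => f v mf /graph_sub Mv.
  by apply/above_graph/smul_above/smul_mem.
- by move=> w /above_low; apply: above_graph.
move=> k kc; have := standard_ords M_std kc; rewrite (graph_ords y) => -[//|kb].
by move: cb; rewrite -kb ltnNge kc.
Qed.

Lemma graph_inj : injective graph.
Proof.
move=> y z yz; apply/ffunP => k; apply/eqP; rewrite -subr_eq0.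
apply/negPn/negP => yzk.
apply: (@graph_ords_b y); exists ((y k - z k)%:A *: vb); last exact: isordA.
have -> : (y k - z k)%:A *: vb = tilt z k - tilt y k.
  by rewrite /tilt opprB [RHS]addrC addrA subrK !scalerBl.
apply: (subspaceB (graph_subspace y)); last exact: tilt_graph.
by rewrite yz; apply: tilt_graph.
Qed.

(** [M'] contains [above], and each [e k] is in [M'] up to a multiple of [vb];
    this gives [y], and then [graph y] and [M'] have the same orders. *)
Lemma graph_surj M' : hyper M M' b -> exists y, graph y = M'.
Proof.
move=> MM'; have [M'std M'M nb _] := MM'.
have M's := standard_subspace M'std.
have aM' : above `<=` M'.
  move=> w [u [mu Mwu lwu]]; apply: (subspaceBr M's (hyper_maxid M_std MM' mu)).
  exact: (hyper_low M_std MM').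
have [y yP] := choice (fun k => hyper_split M_std MM' Mvb vb_ord (Me k)).
exists (finfun y).
have tM' k : M' (tilt (finfun y) k) by rewrite /tilt ffunE.
apply/seteqP; split; first exact: (span_mod_sub M's aM' tM').
apply: (comb_span M's subspace_above aM' above_low tM' (tilt_ord _)) => k M'k.
case: (ltngtP k b) => [kb|bk|kb].
- case: (pselect (ords (mx M) k)) => [|nm].
    by left; apply: ords_sub smul_above _ _.
  by right; apply: idx_surj => //; split=> //; apply: ords_sub M'M _ _.
- by left; apply: ords_above_gt => //; apply: ords_sub M'M _ _.
by case: nb; rewrite -kb.
Qed.

End Family.

Lemma hyper_bij : exists h : {ffun 'I_r -> F} -> set V,
  set_bij [set: {ffun 'I_r -> F}] [set M' | hyper M M' b] h.
Proof.
have [idx [e [idx_inj eP idxP idx_surj]]] := exists_jump_basis.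
have [Me e_ord] := all_and2 eP; have [idx_lt idx_jump] := all_and2 idxP.
have [[vb Mvb vb_ord] _] := Mb.
exists (graph e vb); split=> [y _|y z _ _|M' MM'].
- exact: (@hyper_graph idx).
- exact: (@graph_inj idx).
have [y <-] := graph_surj Me e_ord idx_lt idx_surj Mvb vb_ord MM'.
by exists y.
Qed.

End Count.
End Lattices.

(** * Counting flags *)

Section FiniteSums.
Variable (A : nmodType).

Lemma fsum_fintype (T : finType) (f : T -> A) :
  \sum_(i \in [set: T]) f i = \sum_i f i.
Proof.
rewrite (fsbigE (index_enum T)) ?index_enum_uniq //.
  by apply: eq_bigl => i; rewrite in_setT.
by move=> i _; rewrite mem_index_enum.
Qed.

Lemma fsum_bigcup (I J : choiceType) (D : set I) (S : I -> set J) (f : J -> A) :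
  finite_set D -> (forall i, D i -> finite_set (S i)) -> trivIset D S ->
  \sum_(j \in \bigcup_(i in D) S i) f j = \sum_(i \in D) \sum_(j \in S i) f j.
Proof.
move=> /finite_seqP[s0 ->]; have -> : [set` s0] = [set` undup s0].
  by apply/seteqP; split=> i /=; rewrite mem_undup.
elim: (undup s0) (undup_uniq s0) => [|i s IH] /=.
  by rewrite classical_sets.set_nil bigcup_set0 !fsbig_set0.
move=> /andP[si us] fS tS.
rewrite -(fsbig_seq _ _ (r := i :: s)) /= ?si // big_cons.
rewrite (fsbig_seq _ _ us) -IH //; last first.
- by apply: sub_trivIset tS => j /= sj; rewrite inE sj orbT.
- by move=> j sj; apply: fS => /=; rewrite inE sj orbT.
have -> : [set` i :: s] = i |` [set` s].
  apply/seteqP; split=> j /=; rewrite inE; first by case/predU1P; [left|right].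
  by case=> [->|->]; rewrite ?eqxx ?orbT.
rewrite bigcup_setU1 fsbigU0 //.
- by apply: fS => /=; rewrite mem_head.
- apply: bigcup_finite => [|j sj]; first exact: finite_seq.
  by apply: fS => /=; rewrite inE sj orbT.
move=> x [Six [j /= sj Sjx]].
have ij : i = j.
  apply: tS; rewrite /= ?mem_head ?inE ?sj ?orbT //; last by exists x.
by rewrite ij sj in si.
Qed.

End FiniteSums.

Section Flags.
Variables (F : finFieldType) (R : set {fps F}) (c N : nat).
Notation V := 'rV[{fps F}]_c.+1.
Implicit Types (M : set V) (s : seq (set V)).
Hypotheses (R_subalg : GRing.subalg_closed [in R]) (N_gt0 : (0 < N)%N).
Hypothesis R_cond : forall h, flow N h -> R h.
Local Notation B := (N * c.+1)%N.
Local Notation mx M := (smul (maxid R) M).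

(** A standard module is the preimage of its image among the vectors truncated
    at the index [B]. *)
Lemma finite_standard : finite_set [set M : set V | standard R M].
Proof.
pose T := {ffun 'I_B -> F}.
pose trunc (v : V) : T := [ffun k : 'I_B => cf v k].
pose h (X : {set T}) : set V := [set v | trunc v \in X].
apply: (@sub_finite_set _ _ (h @` setT)); last exact/finite_image/finite_finset.
move=> M M_std; exists [set x | `[< exists2 v, M v & trunc v = x >]]%SET => //.
apply/seteqP; split=> v; rewrite /h /= inE; last first.
  by move=> Mv; apply/asboolP; exists v.
case/asboolP => u Mu /ffunP uv.
have Ms := standard_subspace R_subalg M_std.
rewrite -[v](subrK u); apply: (subspaceD Ms) => //.
apply: (standard_lowM R_subalg N_gt0 R_cond M_std) => k kB.
by have := uv (Ordinal kB); rewrite !ffunE cfB /= => ->; rewrite subrr.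
Qed.

Lemma rkq_jumps M : standard R M -> rkq R M = size (jumps R M B).
Proof.
move=> M_std; have Ms := standard_subspace R_subalg M_std.
have [idx [e [idx_inj eP idxP idx_surj]]] := exists_jump_basis R M B.
apply: (dimqE Ms (subspace_smul _ Ms)).
have [Me e_ord] := all_and2 eP; have [_ idx_jump] := all_and2 idxP.
apply: (comb_dimq Ms (subspace_smul _ Ms) _ _ idx_inj Me e_ord) => [||k|n Mn].
- exact: (smul_maxid_sub R_subalg (standard_submod M_std)).
- exact: (standard_low N_gt0 R_cond M_std).
- by case: (idx_jump k).
case: (pselect (ords (mx M) n)) => [|nm]; first by left.
right; apply: idx_surj => //; rewrite ltnNge; apply/negP => Bn.
have [v Mv vn] := Mn; apply: nm; exists v => //.
by apply: (standard_low N_gt0 R_cond M_std); apply: isord_low vn _.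
Qed.

Lemma jumpsS M b : jumps R M b.+1 =
  if `[< jump R M b >] then rcons (jumps R M b) b else jumps R M b.
Proof.
rewrite /jumps -addn1 iotaD filter_cat /= add0n.
by case: asbool; rewrite ?cats0 // cats1.
Qed.

Lemma eq_jumps M M' b : (forall n, (n < b)%N -> jump R M n <-> jump R M' n) ->
  jumps R M b = jumps R M' b.
Proof.
by move=> H; apply: eq_in_filter => n; rewrite mem_iota => /H /asbool_equiv_eq.
Qed.

Lemma size_jumps_low M b :
  standard R M -> (b <= c.+1)%N -> size (jumps R M b) = b.
Proof.
move=> M_std; elim: b => [//|b IH] bc; rewrite jumpsS asboolT ?size_rcons.
  by rewrite IH // ltnW.
split; first exact: (standard_ords R_subalg M_std).
by move/ords_smul_maxid_gt => cb; rewrite ltnNge cb in bc.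
Qed.

(** The number of jumps below [j] increases by one at each jump, and it is
    [c.+1] at [j = c.+1]. *)
Lemma jumps_prod (A : comNzRingType) (G : nat -> A) M b : standard R M ->
  \prod_(c.+1 <= j < b | `[< jump R M j >]) G (size (jumps R M j)) =
  \prod_(c.+1 <= i < size (jumps R M b)) G i.
Proof.
move=> M_std; elim: b => [|b IH]; first by rewrite !big_geq.
have [bc|cb] := ltnP b c.+1.
  by rewrite size_jumps_low // !big_geq.
rewrite big_mkcond big_nat_recr //= -big_mkcond IH jumpsS.
case: asbool; last by rewrite mulr1.
rewrite size_rcons big_nat_recr //.
have : (size (jumps R M c.+1) <= size (jumps R M b))%N.
  by rewrite -(subnKC cb) /jumps iotaD filter_cat size_cat leq_addr.
by rewrite size_jumps_low.
Qed.

(** The flags with top [M] whose removed indices are all below [b], listed from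
    the bottom as in [standard_flag] but built from the top down: below [M'],
    only indices smaller than the one removed from [M] may be removed. *)
Inductive flag_to : nat -> set V -> seq (set V) -> Prop :=
| flag_to1 b M : flag_to b M [:: M]
| flag_toS b k M M' s : (k < b)%N -> hyper R M M' k -> flag_to k M' s ->
    flag_to b M (rcons s M).

Local Notation flags b M := [set s | flag_to b M s].

Lemma flag_to_inv b M s : flag_to b M s ->
  s = [:: M] \/ exists k M' s',
    [/\ (k < b)%N, hyper R M M' k, flag_to k M' s' & s = rcons s' M].
Proof.
by case=> [|{}b k {}M M' {}s kb MM' Hs]; [left|right; exists k, M', s].
Qed.

Lemma flag_to_last b M s : flag_to b M s -> s <> [::] /\ last set0 s = M.
Proof.
case/flag_to_inv => [->//|[k [M' [s' [_ _ _ ->]]]]].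
by rewrite last_rcons; split=> //; case: s'.
Qed.

Lemma flag_to_leq b b' M s : (b <= b')%N -> flag_to b M s -> flag_to b' M s.
Proof.
move=> bb' /flag_to_inv[->|[k [M' [s' [kb MM' Hs ->]]]]]; first exact: flag_to1.
exact: flag_toS (leq_trans kb bb') MM' Hs.
Qed.

Lemma hyper_lt M M' k : hyper R M M' k -> (k < B)%N.
Proof.
move=> [M'std _ nk Mk]; have [v _ vk] : ords M k by rewrite Mk; right.
rewrite ltnNge; apply/negP => Bk; apply: nk; exists v => //.
by apply: (standard_lowM R_subalg N_gt0 R_cond M'std); apply: isord_low vk _.
Qed.

Lemma flag_to_max b M s : flag_to b M s -> flag_to B M s.
Proof.
case/flag_to_inv => [->|[k [M' [s' [_ MM' Hs ->]]]]]; first exact: flag_to1.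
exact: (flag_toS (hyper_lt MM') MM' Hs).
Qed.

Lemma flagsS b M : flags b.+1 M = flags b M `|`
  \bigcup_(M' in [set M' | hyper R M M' b]) (rcons^~ M @` flags b M').
Proof.
apply/seteqP; split=> s /=.
  case/flag_to_inv => [->|[k [M' [s' [kb MM' Hs ->]]]]].
    by left; apply: flag_to1.
  move: kb; rewrite ltnS leq_eqVlt => /orP[/eqP kb|kb]; last first.
    by left; apply: flag_toS MM' Hs.
  by right; rewrite -kb; exists M' => //; exists s'.
case=> [|[M' MM' [s' Hs <-]]]; first by apply: flag_to_leq.
exact: flag_toS MM' Hs.
Qed.

Lemma flags0 M : flags 0 M = [set [:: M]].
Proof.
apply/seteqP; split=> s /=; last by move=> ->; apply: flag_to1.
by case/flag_to_inv => [//|[k [M' [s' []]]]].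
Qed.

Lemma finite_hyper M b : finite_set [set M' | hyper R M M' b].
Proof. by apply: sub_finite_set finite_standard => M' []. Qed.

Lemma finite_flags b M : finite_set (flags b M).
Proof.
elim: b M => [|b IH] M; first by rewrite flags0; exact: finite_set1.
rewrite flagsS finite_setU; split=> //; apply: bigcup_finite.
  exact: finite_hyper.
by move=> M' _; apply: finite_image.
Qed.

Lemma hyper_inj M M' b k : hyper R M M' b -> hyper R M M' k -> k = b.
Proof.
move=> [_ _ nb Mb] [_ _ nk Mk]; have : ords M k by rewrite Mk; right.
by rewrite Mb => -[].
Qed.

Section Counting.
Variables (A : comNzRingType) (a : A).

Definition flag_sum b M := \sum_(s \in flags b M) a ^+ (size s).-1.

Lemma flag_sumS b M :
  flag_sum b.+1 M = flag_sum b M +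
    \sum_(M' \in [set M' | hyper R M M' b]) a * flag_sum b M'.
Proof.
rewrite /flag_sum flagsS fsbigU0.
- congr (_ + _); rewrite fsum_bigcup; last first.
  + move=> M1 M2 _ _ [s [[s1 /flag_to_last[_ <-] <-]]].
    by case=> s2 /flag_to_last[_ <-] /rcons_inj[->].
  + by move=> M' _; apply/finite_image/finite_flags.
  + exact: finite_hyper.
  apply: eq_fsbigr => M' _; rewrite fsbig_image; last first.
    by move=> s1 s2 _ _ /= E; apply: rcons_injl E.
  rewrite !fsbig_finite; [|exact: finite_flags..].
  rewrite mulr_sumr; apply: eq_big_seq => s.
  rewrite in_fset_set; last exact: finite_flags.
  rewrite inE => /flag_to_last[s0 _]; rewrite size_rcons -exprS prednK //.
  by case: s s0.
- exact: finite_flags.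
- apply: bigcup_finite; first exact: finite_hyper.
  by move=> M' _; apply/finite_image/finite_flags.
move=> s [/= Hs [M' MM' [s' Hs' sE]]].
have [s'0 s'M'] := flag_to_last Hs'.
case: (flag_to_inv Hs) => [E|[k [M1 [s1 [kb MM1 Hs1 E]]]]].
  by move: (congr1 size sE); rewrite E size_rcons => -[/size0nil].
have s's1 : s' = s1 by rewrite E in sE; apply: rcons_injl sE.
have [_ s1M1] := flag_to_last Hs1.
rewrite -s1M1 -s's1 s'M' in MM1.
by have := hyper_inj MM1 MM' => bk; rewrite bk ltnn in kb.
Qed.

(** By induction on [b]: if [b] is a jump beyond the first [c.+1], allowing it
    to be removed from [M] adds, for each of the [q ^ i] modules [M'], a term
    [a * flag_sum b M'], and [flag_sum b M' = flag_sum b M] because [M'] and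
    [M] have the same jumps below [b]. *)
Lemma flag_sumE b M : standard R M ->
  flag_sum b M = \prod_(c.+1 <= j < b | `[< jump R M j >])
    (1 + (#|F| ^ size (jumps R M j))%:R * a).
Proof.
elim: b M => [|b IH] M M_std.
  by rewrite /flag_sum flags0 fsbig_set1 big_geq.
rewrite flag_sumS.
have eqP M' : hyper R M M' b -> flag_sum b M' = flag_sum b M.
  move=> MM'; have [M'std _ _ _] := MM'; rewrite (IH _ M'std) (IH _ M_std).
  rewrite [LHS]big_nat_cond [RHS]big_nat_cond.
  have E j : (j < b)%N -> jump R M' j <-> jump R M j.
    exact: (hyper_jump_lt R_subalg N_gt0 R_cond M_std MM').
  apply: eq_big => [j|j /andP[/andP[_ jb] _]].
    by case: (ltnP j b) => [/E/asbool_equiv_eq ->//|_]; rewrite !andbF.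
  by rewrite (eq_jumps (M' := M)) // => n nj; apply: E; apply: ltn_trans jb.
have [bc|cb] := ltnP b c.+1.
  rewrite (_ : [set M' | _] = set0) ?fsbig_set0 ?addr0.
    by rewrite IH // !big_geq // ltnW.
  apply/seteqP; split=> // M' /(hyper_gt R_subalg) cb.
  by rewrite ltnNge cb in bc.
rewrite [RHS]big_mkcond big_nat_recr //= -big_mkcond -IH //.
case: asboolP => [Mb|nMb]; last first.
  rewrite (_ : [set M' | _] = set0) ?fsbig_set0 ?addr0 ?mulr1 //.
  by apply/seteqP; split=> // M' /(hyper_jump R_subalg N_gt0 R_cond M_std)/nMb.
have [h hb] := hyper_bij R_subalg N_gt0 R_cond M_std cb Mb.
rewrite (reindex_fsbig h _ _ _ hb) fsum_fintype.
rewrite (eq_bigr (fun=> a * flag_sum b M)); last first.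
  by move=> y _; rewrite eqP //; case: hb => + _ _; apply.
rewrite sumr_const card_ffun card_ord mulrDr mulr1 mulr_natl mulrnAr.
by rewrite [a * _]mulrC.
Qed.

Lemma flag_sum_rkq M : standard R M ->
  flag_sum B M = \prod_(c.+1 <= i < rkq R M) (1 + (#|F| ^ i)%:R * a).
Proof.
move=> M_std; rewrite flag_sumE // rkq_jumps //.
exact: (jumps_prod (fun i => 1 + (#|F| ^ i)%:R * a)).
Qed.

End Counting.
End Flags.

(** * From indices to valuations *)

Section Positions.
Variables (F : fieldType) (K : realType) (c : nat) (nu : 'I_c.+1 -> K).
Notation V := 'rV[{fps F}]_c.+1.
Hypotheses (nu0 : forall i : 'I_c.+1, val i = 0%N -> nu i = 0).
Hypotheses (nu_lt : forall i j : 'I_c.+1, (i < j)%N -> nu i < nu j).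
Hypotheses (nu1 : forall i : 'I_c.+1, nu i < 1).

(** The valuation of the monomial of index [n]. *)
Definition pos n : K := (n %/ c.+1)%N%:R + nu (inord (n %% c.+1)).

Lemma nu_ge0 i : 0 <= nu i.
Proof.
case: (posnP i) => [i0|i0]; first by rewrite nu0.
by rewrite ltW // -(nu0 (i := ord0)) //; apply: nu_lt.
Qed.

Lemma pos_entry (i : 'I_c.+1) n : pos (n * c.+1 + i) = n%:R + nu i.
Proof.
by rewrite /pos divnMDl // divn_small // addn0 modnMDl modn_small // inord_val.
Qed.

Lemma pos_lt m n : (m < n)%N -> pos m < pos n.
Proof.
move=> mn; rewrite /pos; have := leq_div2r c.+1 (ltnW mn).
rewrite leq_eqVlt => /orP[/eqP E|lt_q].
  rewrite E ltrD2l; apply: nu_lt; rewrite !inordK ?ltn_pmod //.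
  by move: mn; rewrite {1}(divn_eq m c.+1) {1}(divn_eq n c.+1) E ltn_add2l.
apply: (@lt_le_trans _ _ (m %/ c.+1).+1%:R); first by rewrite -natr1 ltrD2l.
by rewrite (@le_trans _ _ (n %/ c.+1)%:R) ?ler_nat // lerDl nu_ge0.
Qed.

Lemma pos_le m n : (m <= n)%N -> pos m <= pos n.
Proof. by rewrite leq_eqVlt => /orP[/eqP ->//|/pos_lt/ltW]. Qed.

Lemma pos_ltE m n : (pos m < pos n) = (m < n)%N.
Proof.
by case: (ltnP m n) => [/pos_lt //|/pos_le]; rewrite leNgt => /negPf.
Qed.

Lemma pos_inj : injective pos.
Proof.
move=> m n E; case: (ltngtP m n) => // /pos_lt; rewrite E ltxx //.
Qed.

Lemma valzE (f : {fps F}) n :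
  fcoef f n != 0 -> flow n f -> valz K f = (n%:R)%:E.
Proof.
move=> fn lf; rewrite /valz; case: pselect => [exf|[]]; last by exists n.
case: ex_minnP => m fm minm; congr (_%:R%:E); apply/eqP.
rewrite eqn_leq minm //=.
by rewrite leqNgt; apply/negP => /lf /eqP; apply/negP.
Qed.

Lemma valzP (f : {fps F}) :
  valz K f = +oo%E \/ exists2 m, fcoef f m != 0 & valz K f = (m%:R)%:E.
Proof.
rewrite /valz; case: pselect => [exf|_]; last by left.
by case: ex_minnP => m fm _; right; exists m.
Qed.

Lemma val_nu_isord (v : V) n : isord v n -> val_nu nu v = (pos n)%:E.
Proof.
move=> [vn ln]; apply/le_anti/andP; split.
  pose i : 'I_c.+1 := inord (n %% c.+1).
  have vi : valz K (v 0 i) = ((n %/ c.+1)%N%:R)%:E.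
    apply: valzE => // k kn; rewrite -cf_entry; apply: ln.
    rewrite inordK ?ltn_pmod // [ltnRHS](divn_eq n c.+1).
    by rewrite ltn_add2r ltn_pmul2r.
  rewrite /val_nu; apply: (bigmin_inf i) => //.
  by rewrite vi -EFinD.
rewrite /val_nu; apply: le_bigmin => [|i _]; first by rewrite leey.
case: (valzP (v 0 i)) => [->|[m vm ->]]; first by rewrite addye // leey.
rewrite -EFinD lee_fin -pos_entry; apply: pos_le; rewrite leqNgt; apply/negP.
by move=> /ln /eqP; rewrite cf_entry (negPf vm).
Qed.

Lemma Delta_ords (M : set V) : Delta nu M = pos @` ords M.
Proof.
apply/seteqP; split=> x; last first.
  case=> n [v Mv vn] <-; exists v; split=> //; first exact: isord_neq0 vn.
  exact: val_nu_isord.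
case=> v [Mv v0]; have [n vn] := exists_isord v0.
by rewrite (val_nu_isord vn) => -[<-]; exists n => //; exists v.
Qed.

Lemma Delta_pos (M : set V) n : Delta nu M (pos n) <-> ords M n.
Proof.
rewrite Delta_ords; split; last by move=> Mn; exists n.
by case=> m Mm /pos_inj <-.
Qed.

Lemma Delta_jump (M M' : set V) n : ords M = ords M' `|` [set n] <->
  Delta nu M = Delta nu M' `|` [set pos n].
Proof.
rewrite !Delta_ords; split=> [->|E]; first by rewrite image_setU image_set1.
apply/predeqP => m; rewrite -(image_inj (A := ords M) pos_inj) E.
by rewrite -image_set1 -image_setU (image_inj pos_inj).
Qed.

End Positions.

(** * Standard flags *)

Section StandardFlags.
Variables (F : finFieldType) (R : set {fps F}) (c N : nat).
Variables (K : realType) (nu : 'I_c.+1 -> K).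
Notation V := 'rV[{fps F}]_c.+1.
Implicit Types (M : set V) (s : seq (set V)).
Hypotheses (R_subalg : GRing.subalg_closed [in R]) (N_gt0 : (0 < N)%N).
Hypothesis R_cond : forall h, flow N h -> R h.
Hypotheses (nu0 : forall i : 'I_c.+1, val i = 0%N -> nu i = 0).
Hypotheses (nu_lt : forall i j : 'I_c.+1, (i < j)%N -> nu i < nu j).
Hypotheses (nu1 : forall i : 'I_c.+1, nu i < 1).
Local Notation B := (N * c.+1)%N.
Local Notation pos := (pos nu).

Definition flag_jumps (g : nat -> K) l s : Prop :=
  [/\ size s = l.+1, standard R (nth set0 s 0%N),
      (forall i, (i <= l)%N -> is_submod R (nth set0 s i)),
      (forall i, (i < l)%N -> nth set0 s i `<=` nth set0 s i.+1 /\
                              has_dimq (nth set0 s i.+1) (nth set0 s i) 1%N)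
    & (forall i, (i < l)%N -> ~ Delta nu (nth set0 s i) (g i) /\
         Delta nu (nth set0 s i.+1) = Delta nu (nth set0 s i) `|` [set g i]) /\
      (forall i j, (i < j < l)%N -> g i < g j)].

Lemma standard_flag_jumps l s :
  standard_flag nu R l s <-> exists g, flag_jumps g l s.
Proof.
split=> [[? ? ? ? [g ?]]|[g [? ? ? ? ?]]]; first by exists g.
by split=> //; exists g.
Qed.

(** The bound on the last removed value bounds all of them, as they increase;
    it is what the induction needs, since the part of the flag below its top
    must be a flag with removed indices below the one just removed. *)
Lemma flag_jumps_to g l s : flag_jumps g l s ->
  forall b, ((0 < l)%N -> g l.-1 < pos b) ->
  standard R (last set0 s) /\ flag_to R b (last set0 s) s.
Proof.
elim: l s => [|l IH] s [sz s0 sR sS [sD g_lt]] b gb.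
  case: s sz s0 {sR sS sD} => [|M []] //= _ M_std; split=> //; exact: flag_to1.
have {gb} gb := gb isT.
case/lastP: s sz s0 sR sS sD => [//|s' M].
rewrite size_rcons => -[sz] s0 sR sS sD.
rewrite last_rcons; set M' := last set0 s'.
have nthE i : (i <= l)%N -> nth set0 (rcons s' M) i = nth set0 s' i.
  by move=> il; rewrite nth_rcons sz ltnS il.
have nthM : nth set0 (rcons s' M) l.+1 = M by rewrite nth_rcons sz ltnn eqxx.
have nthM' : nth set0 (rcons s' M) l = M' by rewrite nthE // /M' -nth_last sz.
have [M'M _] := sS l (ltnSn l); have [nM' EM] := sD l (ltnSn l).
rewrite nthM nthM' in M'M EM; rewrite nthM' in nM'.
have [k Mk gk] : (pos @` ords M) (g l).
  by rewrite -(Delta_ords nu0 nu_lt nu1) EM; right.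
have [||M'std Hs'] := IH s' _ k.
- split=> //; first by rewrite -nthE.
  + by move=> i il; rewrite -nthE //; apply/sR/leqW.
  + by move=> i il; rewrite -!nthE //; [apply/sS/leqW|apply: ltnW].
  split; last by move=> i j /andP[ij jl]; apply: g_lt; rewrite ij ltnW.
  by move=> i il; rewrite -!nthE //; [apply/sD/leqW|apply: ltnW].
- by move=> l0; rewrite gk; apply: g_lt; rewrite prednK // leqnn ltnSn.
have MR : is_submod R M by rewrite -nthM; apply: sR.
split; first exact: (standard_sup M'std MR M'M).
apply: flag_toS Hs'; first by rewrite -(pos_ltE nu0 nu_lt nu1) gk.
split=> //; first by rewrite -(Delta_pos nu0 nu_lt nu1) gk.
by apply/(Delta_jump nu0 nu_lt nu1); rewrite gk.
Qed.

Lemma flag_to_jumps b M s : flag_to R b M s -> standard R M ->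
  exists g l, flag_jumps g l s /\ forall i, (i < l)%N -> g i < pos b.
Proof.
elim=> {b M s} [b M M_std|b k M M' s kb MM' Hs IH M_std].
  exists (fun=> 0), 0%N; split=> //; split=> //.
    by case=> // _; apply: standard_submod.
  by split=> // i j; rewrite ltn0 andbF.
have [M'std M'M nk Mk] := MM'.
have [g [l [[sz s0 sR sS [sD g_lt]] gk]]] := IH M'std.
have [_ sM'] := flag_to_last Hs.
have nthE i : (i <= l)%N -> nth set0 (rcons s M) i = nth set0 s i.
  by move=> il; rewrite nth_rcons sz ltnS il.
have nthM : nth set0 (rcons s M) l.+1 = M by rewrite nth_rcons sz ltnn eqxx.
have nthM' : nth set0 (rcons s M) l = M' by rewrite nthE // -sM' -nth_last sz.
exists (fun i => if (i < l)%N then g i else pos k), l.+1; split.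
  split; first by rewrite size_rcons sz.
  - by rewrite nthE.
  - move=> i; rewrite leq_eqVlt ltnS => /predU1P[->|il].
      by rewrite nthM; apply: standard_submod.
    by rewrite nthE //; apply: sR.
  - move=> i; rewrite ltnS leq_eqVlt => /predU1P[->|il].
      rewrite nthM nthM'; split=> //.
      exact: (hyper_dimq R_subalg N_gt0 R_cond M_std MM').
    by rewrite !nthE //; [apply: sS|apply: ltnW].
  split.
    move=> i; rewrite ltnS leq_eqVlt => /predU1P[->|il].
      rewrite nthM nthM' ltnn (Delta_pos nu0 nu_lt nu1); split=> //.
      exact/(Delta_jump nu0 nu_lt nu1).
    by rewrite il !nthE //; [apply: sD|apply: ltnW].
  move=> i j /andP[ij]; rewrite ltnS leq_eqVlt => /predU1P[jl|jl].
    by rewrite jl ltnn -jl ij; apply: gk; rewrite -jl.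
  by rewrite jl (ltn_trans ij jl); apply: g_lt; rewrite ij.
move=> i _; case: ifP => [il|_]; last exact: pos_lt.
by apply: (lt_trans (gk i il)); apply: pos_lt.
Qed.

Lemma standard_flagsE : standard_flags nu R =
  \bigcup_(M in [set M : set V | standard R M]) [set s | flag_to R B M s].
Proof.
apply/seteqP; split=> s.
  case=> l /standard_flag_jumps[g sg].
  have [b gb] : exists b, (0 < l)%N -> g l.-1 < pos b.
    case: (posnP l) => [->|l0]; first by exists 0%N.
    case: sg => _ _ _ _ [sD _].
    have lt_l : (l.-1 < l)%N by rewrite prednK.
    have [_ E] := sD _ lt_l.
    have [k _ <-] : (pos @` ords (nth set0 s l.-1.+1)) (g l.-1).
      by rewrite -(Delta_ords nu0 nu_lt nu1) E; right.
    by exists k.+1 => _; apply: pos_lt.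
  have [M_std Hs] := flag_jumps_to sg gb; exists (last set0 s) => //.
  exact: (flag_to_max R_subalg N_gt0 R_cond Hs).
case=> M M_std /= Hs; have [g [l [sg _]]] := flag_to_jumps Hs M_std.
by exists l; apply/standard_flag_jumps; exists g.
Qed.

(** The theorem for any subalgebra that contains [z ^ N F[[z]]]. *)
Lemma Hmot_conductor (A : comNzRingType) (t a : A) :
  [/\ finite_set (standard_flags nu R),
      (forall M : set V, standard R M -> (c.+1 <= rkq R M)%N)
    & Hmot nu R t a =
      \sum_(M \in [set M : set V | standard R M])
        t ^+ degq M * \prod_(c.+1 <= i < rkq R M) (1 + (#|F| ^ i)%:R * a)].
Proof.
have fin_std := finite_standard c R_subalg N_gt0 R_cond.
have fin_flags M : finite_set [set s | flag_to R B M s].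
  exact: (finite_flags R_subalg N_gt0 R_cond).
rewrite /Hmot standard_flagsE; split.
- exact: bigcup_finite.
- move=> M M_std; rewrite (rkq_jumps R_subalg N_gt0 R_cond M_std).
  have BE : (c.+1 <= B)%N by rewrite leq_pmull.
  rewrite -{1}(size_jumps_low R_subalg M_std (leqnn c.+1)).
  by rewrite -(subnKC BE) /jumps iotaD filter_cat size_cat leq_addr.
rewrite fsum_bigcup //; last first.
  by move=> M M' _ _ [s [/flag_to_last[_ <-] /flag_to_last[_ <-]]].
apply: eq_fsbigr => M; rewrite inE => M_std.
rewrite -(flag_sum_rkq R_subalg N_gt0 R_cond _ M_std) /flag_sum.
rewrite !fsbig_finite // mulr_sumr; apply: eq_big_seq => s.
by rewrite in_fset_set // inE => /flag_to_last[_ ->].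
Qed.

End StandardFlags.

Theorem theorem6p2 (F : finFieldType) (R : set {fps F})
    (K : realType) (c : nat) (nu : 'I_c -> K)
    (A : comNzRingType) (t a : A) :
  unibranch_singularity_ring R ->
  (1 <= c)%N ->
  (forall i : 'I_c, val i = 0%N -> nu i = 0) ->
  (forall i j : 'I_c, (i < j)%N -> nu i < nu j) ->
  (forall i : 'I_c, nu i < 1) ->
  [/\ finite_set (standard_flags nu R),
      (forall M : set 'rV[{fps F}]_c, standard R M -> (c <= rkq R M)%N)
    & Hmot nu R t a =
      \sum_(M \in [set M : set 'rV[{fps F}]_c | standard R M])
        t ^+ degq M * \prod_(c <= i < rkq R M) (1 + (#|F| ^ i)%:R * a)].
Proof.
move=> [R_subalg R_local R_frac]; case: c nu => // c nu _ nu0 nu_lt nu1.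
have [N N_gt0 R_cond] := conductor R_subalg R_local R_frac.
exact: (Hmot_conductor R_subalg N_gt0 R_cond nu0 nu_lt nu1).
Qed.
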